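(* Let $K$ be the function field of a smooth proper curve over a finite field, and let $L_1,\ldots,L_n$ be linear forms over $K$ in variables $X_1,\ldots,X_r$, with $r<n$. Then the non-deterministic system $L_1(X_1,\ldots,X_r)\stackrel{d}{=}\cdots\stackrel{d}{=}L_n(X_1,\ldots,X_r)$ has a solution over $K$ if and only if it has a solution over the completion $K_v$ for every place $v$ of $K$.
   Context: For $F$ equal to $K$ (with the discrete topology) or a completion $K_v$, a solution over $F$ of the system $L_1\stackrel{d}{=}\cdots\stackrel{d}{=}L_n$ is a compactly supported (for $F=K$: finitely supported) probability distribution of a random vector $X=(X_1,\ldots,X_r)$ in $F^r$, not equal to the point mass at the origin, such that $L_1(X),\ldots,L_n(X)$ are all equal in distribution. *)

(* Defs.v *)
From HB Require Import structures.
From mathcomp Require Import all_boot all_order all_algebra all_field.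
From mathcomp Require Import all_classical all_reals all_analysis.

Set Implicit Arguments.
Unset Strict Implicit.
Unset Printing Implicit Defensive.

Import Order.TTheory GRing.Theory Num.Theory.

Local Open Scope classical_set_scope.
Local Open Scope ring_scope.

(* Normalized discrete valuation. The usual value +oo at 0 is replaced by an
   unconstrained junk value [dv 0]; every use below is guarded by [x != 0].
   For K the function field of a curve over a finite field k, i.e. a finite
   extension of k(t), these valuations are exactly the places of K; triviality
   on k is automatic as k^* is torsion. *)
Record discrete_valuation (F : fieldType) := DiscreteValuation {
  dv :> F -> int;
  dvM : forall x y : F, x != 0 -> y != 0 -> dv (x * y) = dv x + dv y;
  dvD : forall x y : F, x != 0 -> y != 0 -> x + y != 0 ->
    Num.min (dv x) (dv y) <= dv (x + y);
  dv_surj : forall m : int, exists2 x : F, x != 0 & dv x = m }.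

(* [x] lies in the N-th power of the maximal ideal of [w]. *)
Definition dv_small (F : fieldType) (w : discrete_valuation F) (N : int)
  (x : F) : Prop := x = 0 \/ N <= w x.

Lemma dv_small0 (F : fieldType) (w : discrete_valuation F) N : dv_small w N 0.
Proof. by left. Qed.

Lemma dvN (F : fieldType) (w : discrete_valuation F) x :
  x != 0 -> w (- x) = w x.
Proof.
move=> x0; have n1 : (-1 : F) != 0 by rewrite oppr_eq0 oner_eq0.
have w1 : w 1 = 0.
  by apply: (addrI (w 1)); rewrite -dvM ?oner_eq0// mulr1 addr0.
have wn1 : w (-1) = 0.
  have /eqP : w (-1) + w (-1) = 0 by rewrite -dvM// mulrNN mulr1 w1.
  by rewrite -mulr2n mulrn_eq0 /= => /eqP.
by rewrite -mulN1r dvM// wn1 add0r.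
Qed.

Lemma dv_smallN (F : fieldType) (w : discrete_valuation F) N x :
  dv_small w N x -> dv_small w N (- x).
Proof.
have [->|x0] := eqVneq x 0; first by rewrite oppr0.
case=> [/eqP|Nx]; first by rewrite (negPf x0).
by right; rewrite dvN.
Qed.

Lemma dv_smallD (F : fieldType) (w : discrete_valuation F) N x y :
  dv_small w N x -> dv_small w N y -> dv_small w N (x + y).
Proof.
have [->|x0] := eqVneq x 0; first by rewrite add0r.
have [->|y0] := eqVneq y 0; first by rewrite addr0.
have [->|xy0] := eqVneq (x + y) 0; first by left.
case=> [/eqP|Nx]; first by rewrite (negPf x0).
case=> [/eqP|Ny]; first by rewrite (negPf y0).
by right; apply: le_trans (dvD w x0 y0 xy0); rewrite le_min Nx.
Qed.

(* The topology need not be compatible with the operations here; it is in both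
   instances below. *)
#[short(type="preTopologicalFieldType")]
HB.structure Definition PreTopologicalField :=
  {F of GRing.Field F & Topological F}.

HB.instance Definition _ (F : preTopologicalFieldType) := isPointed.Build F 0.

(* Alias of [F] carrying the [w]-adic uniform structure. *)
Definition adic (F : fieldType) (w : discrete_valuation F) : Type := F.

Section adic_uniform.
Variables (F : fieldType) (w : discrete_valuation F).
Local Open Scope relation_scope.

HB.instance Definition _ := GRing.Field.copy (adic w) F.
HB.instance Definition _ := isPointed.Build (adic w) 0.

Definition adic_ent : set_system (adic w * adic w) :=
  filter_from [set: int]
    (fun N => [set xy | dv_small w N ((xy.2 : F) - (xy.1 : F))]).

Lemma adic_ent_filter : Filter adic_ent.
Proof.
apply: filter_from_filter => [|M N _ _]; first by exists 0.
exists (Num.max M N) => // -[x y] /= [->|].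
  by split; left.
by rewrite ge_max => /andP[Mxy Nxy]; split; right.
Qed.

Lemma adic_ent_refl A : adic_ent A -> diagonal `<=` A.
Proof.
rewrite /diagonal/= => -[N _ NA] [x y] /= <-; apply: NA => /=.
by rewrite subrr; exact: dv_small0.
Qed.

Lemma adic_ent_inv A : adic_ent A -> adic_ent A^-1.
Proof.
move=> [N _ NA]; exists N => // -[x y] /= xy.
by apply: NA => /=; rewrite -opprB; exact: dv_smallN.
Qed.

Lemma adic_ent_split A : adic_ent A -> exists2 B, adic_ent B & B \; B `<=` A.
Proof.
move=> [N _ NA].
exists [set xy | dv_small w N ((xy.2 : F) - (xy.1 : F))]; first by exists N.
move=> [x z] [y /= xy yz]; apply: NA => /=.
by rewrite -(subrKA (y : F)); exact: dv_smallD.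
Qed.

HB.instance Definition _ := isUniform.Build (adic w)
  adic_ent_filter adic_ent_refl adic_ent_inv adic_ent_split.

End adic_uniform.

HB.instance Definition _ (K : fieldType) :=
  GRing.Field.copy (discrete_topology K) K.
HB.instance Definition _ (K : fieldType) :=
  isPointed.Build (discrete_topology K) 0.

(* A completion of [K] at [v]: a complete discretely valued field containing
   [K] as a dense subfield, with valuation extending [v]. It is unique up to
   isomorphism over [K]. *)
Record completion (K : fieldType) (v : discrete_valuation K) := Completion {
  completion_field : fieldType;
  completion_dv : discrete_valuation completion_field;
  completion_emb : {rmorphism K -> completion_field};
  completion_dvE : forall x, x != 0 -> completion_dv (completion_emb x) = v x;
  completion_dense : dense (range completion_emb : set (adic completion_dv));
  completion_complete : forall G : set_system (adic completion_dv),
    ProperFilter G -> cauchy G -> cvg G }.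

Definition completed (K : fieldType) (v : discrete_valuation K)
  (Kv : completion v) : preTopologicalFieldType := adic (completion_dv Kv).

Definition linear_form (F : fieldType) (r : nat) (a x : 'rV[F]_r) : F :=
  \sum_(j < r) a 0 j * x 0 j.

Notation borel T := (g_sigma_algebraType (@open T)).

Section solution.
Variables (R : realType) (F : preTopologicalFieldType) (n r : nat).
Variable L : 'I_n -> 'rV[F]_r.

(* [mu] is the law of the random vector [X]. In the Hausdorff second countable
   spaces considered here, compact support amounts to being carried by a
   compact set; for discrete [F], the compact sets of F^r are the finite ones. *)
Definition is_solution (mu : probability (borel 'rV[F]_r) R) : Prop :=
  [/\ exists C : set 'rV[F]_r,
        [/\ compact C, measurable (C : set (borel 'rV[F]_r)) & mu C = 1%E],
      ~ (forall B : set (borel 'rV[F]_r), measurable B ->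
           mu B = dirac ((0 : 'rV[F]_r) : borel 'rV[F]_r) B)
    & forall (i j : 'I_n) (B : set (borel F)), measurable B ->
        pushforward mu (linear_form (L i) : borel 'rV[F]_r -> borel F) B =
        pushforward mu (linear_form (L j) : borel 'rV[F]_r -> borel F) B].

Definition has_solution : Prop :=
  exists mu : probability (borel 'rV[F]_r) R, is_solution mu.

End solution.

(* Main.v *)
(* We may assume that the L_i have no common zero but 0. Over K_v, almost all
   values of every L_i lie in the same smallest ball, and L_i reaches the
   boundary of that ball, so for each i and v there is x in K^r with L_i x <> 0
   and v(L_i x) <= v(L_j x) for all j. Conversely, in positive characteristic it is
   enough to find a nonzero finite subgroup V of K^r with the same image U under
   all the L_i, as each L_i then maps the uniform law on V to the uniform law
   on U.

   Geometrically, the local conditions say that the vector bundle of the x with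
   all L_j x integral surjects onto the structure sheaf through each L_i; after
   a twist of large degree, H^1 of the kernels vanishes and L_i is surjective on
   global sections, which are finite in number. Concretely, let A be the
   integral closure of k[t], or of k[1/t], in K. The values a = L_i x with all
   L_j x in A form an ideal of A; if it were contained in a prime ideal M, the
   localization A_M would be the ring of a place violating the local condition.
   Hence there are x0 and x1 with L_i x0 = L_i x1 = 1, whose L_j are all integral
   over k[t] and k[1/t] respectively. Take a k[t]-lattice N in K stable under
   the L_j x0 and a lattice N' over the local ring at infinity stable under the
   L_j x1. For u in U = N /\ t^m N', with m large, the decomposition
   K = q N + t^(m - c) N' allows one to correct u x0 by a multiple of x0 - x1
   into a vector w with L_i w = u and all L_j w in U. *)
Require Import Defs.
From HB Require Import structures.
From mathcomp Require Import all_boot all_order all_algebra all_field.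
From mathcomp Require Import all_classical all_reals all_analysis.
From mathcomp Require Import ring_quotient ring zify.

Set Implicit Arguments.
Unset Strict Implicit.
Unset Printing Implicit Defensive.

Import Order.TTheory GRing.Theory Num.Theory.

Local Open Scope ring_scope.
Local Open Scope classical_set_scope.

(** * Valuations and completions *)

Section dv_theory.
Variables (F : fieldType) (w : discrete_valuation F).
Implicit Types (x y : F) (M N : int).

Lemma dv1 : w 1 = 0.
Proof. by apply: (addrI (w 1)); rewrite -dvM ?oner_eq0// mulr1 addr0. Qed.

Lemma dvV x : x != 0 -> w x^-1 = - w x.
Proof.
by move=> x0; apply/eqP; rewrite -addr_eq0 -dvM ?invr_eq0// mulVf// dv1.
Qed.

Lemma dv_smallE N x : x != 0 -> dv_small w N x <-> N <= w x.
Proof. by move=> x0; split=> [[/eqP|]|]; [rewrite (negPf x0)| |right]. Qed.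

Lemma dv_small_le M N x : M <= N -> dv_small w N x -> dv_small w M x.
Proof. by move=> MN [->|Nx]; [left|right; exact: le_trans Nx]. Qed.

Lemma dv_smallB N x y :
  dv_small w N x -> dv_small w N y -> dv_small w N (x - y).
Proof. by move=> Nx Ny; apply: dv_smallD => //; exact: dv_smallN. Qed.

Lemma dv_smallM M N x y :
  dv_small w M x -> dv_small w N y -> dv_small w (M + N) (x * y).
Proof.
case=> [->|Mx]; first by rewrite mul0r; left.
case=> [->|Ny]; first by rewrite mulr0; left.
have [->|x0] := eqVneq x 0; first by rewrite mul0r; left.
have [->|y0] := eqVneq y 0; first by rewrite mulr0; left.
by right; rewrite dvM// lerD.
Qed.

Lemma dv_small_sum N (I : Type) (s : seq I) (P : pred I) (f : I -> F) :
  (forall i, P i -> dv_small w N (f i)) ->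
  dv_small w N (\sum_(i <- s | P i) f i).
Proof.
move=> Nf; elim/big_ind : _ => //; first exact: dv_small0.
by move=> x y; exact: dv_smallD.
Qed.

(** The isosceles property of an ultrametric, applied to x = -(y - x) + y and to y = (y - x) + x. *)
Lemma dv_near N x y : x != 0 -> w x < N -> dv_small w N (y - x) ->
  y != 0 /\ w y = w x.
Proof.
move=> x0 xN Nyx.
have y0 : y != 0.
  apply/eqP => y0; move: Nyx; rewrite y0 sub0r.
  by rewrite dv_smallE ?oppr_eq0// dvN// leNgt xN.
split=> //; have [->//|yx] := eqVneq y x.
have yx0 : y - x != 0 by rewrite subr_eq0.
move: Nyx; rewrite dv_smallE// => Nyx.
apply/eqP; rewrite eq_le; apply/andP; split.
  have xE : x = - (y - x) + y by rewrite opprB subrK.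
  have := dvD w (x := - (y - x)) (y := y); rewrite -xE oppr_eq0 dvN//.
  by move=> /(_ yx0 y0 x0); rewrite ge_min leNgt (lt_le_trans xN Nyx).
have := dvD w yx0 x0; rewrite subrK => /(_ y0) /(le_trans _); apply.
by rewrite le_min lexx andbT (ltW (lt_le_trans xN Nyx)).
Qed.

Lemma dv_small_eq0 x : (forall N, dv_small w N x) -> x = 0.
Proof.
move=> Nx; apply/eqP/negP => /negP x0.
by have := Nx (w x + 1); rewrite dv_smallE// leNgt ltrDl ltr01.
Qed.

Lemma adic_nbhsP (a : adic w) (A : set (adic w)) :
  nbhs a A <-> exists N, forall y : adic w, dv_small w N ((y : F) - (a : F)) -> A y.
Proof.
rewrite -nbhs_entourageE; split.
  move=> [B [N _ NB] BA]; exists N => y Ny; apply: BA.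
  by apply/xsectionP; exact: NB.
move=> [N NA]; exists [set xy : adic w * adic w | dv_small w N ((xy.2 : F) - (xy.1 : F))].
  by exists N.
by move=> y /xsectionP /= /NA.
Qed.

End dv_theory.

(** * Existence of a completion: Cauchy sequences modulo null sequences *)

Section completion_existence.
Variables (K : fieldType) (v : discrete_valuation K).
Implicit Types u : nat -> K.

Definition dv_cauchy u := forall N : int, exists n0 : nat, forall m n : nat,
  (n0 <= m)%N -> (n0 <= n)%N -> dv_small v N (u m - u n).

Definition dv_null u := forall N : int, exists n0 : nat, forall n : nat,
  (n0 <= n)%N -> dv_small v N (u n).

Lemma dv_cauchy_bounded u : dv_cauchy u -> exists (M : int) (n0 : nat),
  forall n, (n0 <= n)%N -> dv_small v M (u n).
Proof.
move=> /(_ 0)[n0 un0]; have [un00|un00] := eqVneq (u n0) 0.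
  by exists 0, n0 => n n0n; have := un0 _ _ n0n (leqnn _); rewrite un00 subr0.
exists (Num.min 0 (v (u n0))), n0 => n n0n.
rewrite -[u n](subrK (u n0)); apply: dv_smallD.
  by apply: dv_small_le (un0 _ _ n0n (leqnn _)); rewrite ge_min lexx.
by rewrite dv_smallE// ge_min lexx orbT.
Qed.

Lemma dv_cauchy_cst (c : K) : dv_cauchy (fun=> c).
Proof. by move=> N; exists 0%N => m n _ _; rewrite subrr; left. Qed.

Lemma dv_cauchyB u1 u2 : dv_cauchy u1 -> dv_cauchy u2 -> dv_cauchy (u1 - u2).
Proof.
move=> c1 c2 N; have [n1 h1] := c1 N; have [n2 h2] := c2 N.
exists (maxn n1 n2) => m n; rewrite !geq_max => /andP[m1 m2] /andP[k1 k2].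
rewrite [X in dv_small _ _ X](_ : _ = (u1 m - u1 n) - (u2 m - u2 n)).
  by apply: dv_smallB; [exact: h1|exact: h2].
by rewrite !fctE !opprB addrACA [RHS]addrACA; congr (_ + _); rewrite addrC.
Qed.

Lemma dv_cauchyM u1 u2 : dv_cauchy u1 -> dv_cauchy u2 -> dv_cauchy (u1 * u2).
Proof.
move=> c1 c2 N.
have [M1 [n1 h1]] := dv_cauchy_bounded c1.
have [M2 [n2 h2]] := dv_cauchy_bounded c2.
have [n3 h3] := c1 (N - M2); have [n4 h4] := c2 (N - M1).
exists (maxn (maxn n1 n2) (maxn n3 n4)) => m n; rewrite !geq_max.
move=> /andP[/andP[m1 m2] /andP[m3 m4]] /andP[/andP[k1 k2] /andP[k3 k4]].
rewrite [X in dv_small _ _ X](_ : _ = (u1 m - u1 n) * u2 m + u1 n * (u2 m - u2 n)).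
  apply: dv_smallD.
    by rewrite -[N](subrK M2); apply: dv_smallM; [exact: h3|exact: h2].
  by rewrite -[N](subrKC M1); apply: dv_smallM; [exact: h1|exact: h4].
by rewrite !fctE mulrBl mulrBr addrA subrK.
Qed.

Definition cauchy_pred : {pred nat -> K} := [pred u | `[< dv_cauchy u >]].

Lemma cauchy_predP u : reflect (dv_cauchy u) (u \in cauchy_pred).
Proof. exact: asboolP. Qed.

Lemma cauchy_subring : subring_closed cauchy_pred.
Proof.
split; first exact/cauchy_predP/dv_cauchy_cst.
- by move=> x y /cauchy_predP ? /cauchy_predP ?; exact/cauchy_predP/dv_cauchyB.
- by move=> x y /cauchy_predP ? /cauchy_predP ?; exact/cauchy_predP/dv_cauchyM.
Qed.

HB.instance Definition _ :=
  GRing.isSubringClosed.Build (nat -> K) cauchy_pred cauchy_subring.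

Record cauchy_seq := CauchySeq { cseq : nat -> K ; _ : cseq \in cauchy_pred }.
HB.instance Definition _ := [isSub for cseq].
HB.instance Definition _ := [Choice of cauchy_seq by <:].
HB.instance Definition _ := [SubChoice_isSubComNzRing of cauchy_seq by <:].

Definition null_pred : {pred cauchy_seq} := [pred s | `[< dv_null (cseq s) >]].

Lemma null_predP (s : cauchy_seq) :
  reflect (dv_null (val s)) (s \in null_pred).
Proof. exact: asboolP. Qed.

Lemma cseqP (u : cauchy_seq) : dv_cauchy (val u).
Proof. by case: u => u /= /cauchy_predP. Qed.

Lemma null_idealr : idealr_closed null_pred.
Proof.
split.
- by apply/null_predP => N; exists 0%N => n _; rewrite rmorph0; left.
- apply/negP => /null_predP /(_ 1)[n0 /(_ _ (leqnn _))].
  by rewrite rmorph1 dv_smallE ?oner_eq0// dv1.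
- move=> a x y /null_predP x0 /null_predP y0; apply/null_predP => N.
  have [M [n1 h1]] := dv_cauchy_bounded (cseqP a).
  have [n2 h2] := x0 (N - M); have [n3 h3] := y0 N.
  exists (maxn n1 (maxn n2 n3)) => n; rewrite !geq_max => /and3P[k1 k2 k3].
  rewrite rmorphD rmorphM; apply: dv_smallD; last exact: h3.
  by rewrite -[N](subrKC M); apply: dv_smallM; [exact: h1|exact: h2].
Qed.

HB.instance Definition _ := isIdealr.Build cauchy_seq null_pred null_idealr.

Definition cfield : Type := {ideal_quot null_pred}.
HB.instance Definition _ := GRing.ComNzRing.copy cfield {ideal_quot null_pred}.
HB.instance Definition _ := EqQuotient.copy cfield {ideal_quot null_pred}.

Definition cpi : cauchy_seq -> cfield := \pi_(cfield)%qT.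

Lemma cpi_zmod : zmod_morphism cpi.
Proof. by move=> x y; rewrite /cpi rmorphB. Qed.

Lemma cpi_monoid : monoid_morphism cpi.
Proof. by split=> [|x y]; rewrite /cpi ?rmorph1 ?rmorphM. Qed.

HB.instance Definition _ := GRing.isZmodMorphism.Build _ _ cpi cpi_zmod.
HB.instance Definition _ := GRing.isMonoidMorphism.Build _ _ cpi cpi_monoid.

Definition crepr (x : cfield) : cauchy_seq := repr x.

Lemma creprK : cancel crepr cpi.
Proof. by move=> x; exact: reprK. Qed.

Lemma cpi_eq0 (s : cauchy_seq) : cpi s = 0 <-> dv_null (val s).
Proof.
rewrite -(rmorph0 cpi); split.
  by move=> /eqP; rewrite -Quotient.idealrBE subr0 => /null_predP.
move=> s0; apply/eqP; rewrite -Quotient.idealrBE subr0.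
exact/null_predP.
Qed.

(** For some [N], a term past the Cauchy threshold of [N] has valuation below [N]; all terms past
    the threshold are [N]-close to it, so [dv_near] freezes their valuation. *)
Lemma cpi_neq0 (s : cauchy_seq) : cpi s != 0 ->
  exists (m : int) (n0 : nat), forall n, (n0 <= n)%N ->
    val s n != 0 /\ v (val s n) = m.
Proof.
move=> /eqP /cpi_eq0 /existsNP[N] /forallNP sN.
have [n0 h0] := cseqP s N.
have /existsNP[n1 /not_implyP[n01]] := sN n0.
have [->|s1 ] := eqVneq (val s n1) 0; first by case; left.
rewrite dv_smallE// => /negP; rewrite -ltNge => s1N.
exists (v (val s n1)), n0 => n n0n.
exact: dv_near s1 s1N (h0 _ _ n0n n01).
Qed.

(** As 1/u_i - 1/u_j = (u_j - u_i) / (u_i u_j), inversion costs [m + m] in precision. *)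
Lemma dv_cauchyV u (m : int) (n0 : nat) :
  (forall n, (n0 <= n)%N -> u n != 0 /\ v (u n) = m) ->
  dv_cauchy u -> dv_cauchy (fun n => (u n)^-1).
Proof.
move=> um cu N; have [n1 h1] := cu (N + (m + m)).
exists (maxn n0 n1) => i j; rewrite !geq_max => /andP[i0 i1] /andP[j0 j1].
have [ui vi] := um _ i0; have [uj vj] := um _ j0.
rewrite [X in dv_small _ _ X](_ : _ = (u j - u i) * (u i * u j)^-1).
  rewrite -[N](addrK (m + m)); apply: dv_smallM; first exact: h1.
  by right; rewrite dvV ?mulf_neq0// dvM// vi vj.
by rewrite mulrBl !invfM mulrCA divff// mulr1 mulrA divff// mul1r.
Qed.

(** Termwise inversion of a representative. For a nonzero class only finitely many terms vanish, and
    by [dv_cauchyV] the default of [insubd] does not occur. *)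
Definition cinv (x : cfield) : cfield :=
  if x == 0 then 0 else cpi (insubd 0 (fun n => (val (crepr x) n)^-1)).

Lemma cmulVf x : x != 0 -> cinv x * x = 1.
Proof.
move=> x0; rewrite /cinv (negPf x0).
have [m [n0 h0]] : exists (m : int) (n0 : nat), forall n, (n0 <= n)%N ->
    val (crepr x) n != 0 /\ v (val (crepr x) n) = m.
  by apply: cpi_neq0; rewrite creprK.
rewrite -{2}[x]creprK -rmorphM -(rmorph1 cpi); apply/eqP.
rewrite -subr_eq0 -rmorphB; apply/eqP/cpi_eq0 => N; exists n0 => n /h0[xn _].
rewrite !(rmorphB, rmorphM, rmorph1)/= insubdK; last first.
  exact/cauchy_predP/(dv_cauchyV h0)/cseqP.
by rewrite !fctE mulVf// subrr; left.
Qed.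

Lemma cinv0 : cinv 0 = 0.
Proof. by rewrite /cinv eqxx. Qed.

HB.instance Definition _ := GRing.ComNzRing_isField.Build cfield cmulVf cinv0.

(** The eventual valuation of a representative; the default 0 is taken only at the zero class. *)
Definition cdv (x : cfield) : int :=
  xget 0 [set m | exists n0 : nat, forall n, (n0 <= n)%N ->
    val (crepr x) n != 0 /\ v (val (crepr x) n) = m].

Lemma cdvP (s : cauchy_seq) : cpi s != 0 -> exists n0 : nat, forall n,
  (n0 <= n)%N -> val s n != 0 /\ v (val s n) = cdv (cpi s).
Proof.
move=> s0; have [m [n0 h0]] := cpi_neq0 s0; exists n0 => n n0n.
suff -> : cdv (cpi s) = m by exact: h0.
set r := crepr (cpi s).
have /cpi_eq0 rs0 : cpi (r - s) = 0 by rewrite rmorphB /= /r creprK subrr.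
(* Two representatives differ by a null sequence; once the difference has precision [m + 1], their
   terms have the same valuation. *)
have [n1 h1] := rs0 (m + 1).
have key k : (maxn n0 n1 <= k)%N -> val r k != 0 /\ v (val r k) = m.
  rewrite geq_max => /andP[/h0[sk vk] /h1].
  by rewrite rmorphB -vk => /(dv_near sk); apply; rewrite ltrDl.
rewrite /cdv; case: xgetP => [_ -> [n2 h2]|/(_ m)]; last first.
  by case; exists (maxn n0 n1).
have [_ <-] := h2 (maxn (maxn n0 n1) n2) (leq_maxr _ _).
by have [_ ->] := key (maxn (maxn n0 n1) n2) (leq_maxl _ _).
Qed.

Lemma cdv_uniq (s : cauchy_seq) m (n0 : nat) : cpi s != 0 ->
  (forall n, (n0 <= n)%N -> v (val s n) = m) -> cdv (cpi s) = m.
Proof.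
move=> /cdvP[n1 h1] /(_ (maxn n0 n1) (leq_maxl _ _)) <-.
by have [_ ->] := h1 _ (leq_maxr n0 n1).
Qed.

Lemma cdvM x y : x != 0 -> y != 0 -> cdv (x * y) = cdv x + cdv y.
Proof.
rewrite -(creprK x) -(creprK y) => x0 y0.
have [n1 h1] := cdvP x0; have [n2 h2] := cdvP y0.
rewrite -rmorphM; apply: (@cdv_uniq _ _ (maxn n1 n2)).
  by rewrite rmorphM mulf_neq0.
move=> n; rewrite geq_max => /andP[/h1[a0 <-] /h2[b0 <-]].
by rewrite rmorphM/= dvM.
Qed.

Lemma cdvD x y : x != 0 -> y != 0 -> x + y != 0 ->
  Num.min (cdv x) (cdv y) <= cdv (x + y).
Proof.
rewrite -(creprK x) -(creprK y) => x0 y0; rewrite -rmorphD => xy0.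
have [n1 h1] := cdvP x0; have [n2 h2] := cdvP y0; have [n3 h3] := cdvP xy0.
have [a0 <-] := h1 (maxn n1 (maxn n2 n3)) (leq_maxl _ _).
have [|b0 <-] := h2 (maxn n1 (maxn n2 n3)).
  by rewrite 2!leq_max leqnn orbT.
have [|ab0 <-] := h3 (maxn n1 (maxn n2 n3)).
  by rewrite 2!leq_max leqnn !orbT.
by rewrite rmorphD/= in ab0 *; exact: dvD.
Qed.

Definition cst_seq (c : K) : cauchy_seq := insubd 0 (fun=> c).

Lemma cst_seqE c : val (cst_seq c) = (fun=> c).
Proof. by rewrite insubdK//; exact/cauchy_predP/dv_cauchy_cst. Qed.

Definition cemb (c : K) : cfield := cpi (cst_seq c).

Lemma cemb_zmod : zmod_morphism cemb.
Proof.
move=> x y; rewrite /cemb -rmorphB; congr cpi; apply: val_inj.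
by rewrite rmorphB/= -!/(val _) !cst_seqE.
Qed.

Lemma cemb_monoid : monoid_morphism cemb.
Proof.
split=> [|x y]; rewrite /cemb; last rewrite -rmorphM.
  rewrite -(rmorph1 cpi); congr cpi; apply: val_inj.
  by rewrite rmorph1 /= -!/(val _) !cst_seqE.
congr cpi; apply: val_inj.
by rewrite rmorphM/= -!/(val _) !cst_seqE.
Qed.

HB.instance Definition _ := GRing.isZmodMorphism.Build _ _ cemb cemb_zmod.
HB.instance Definition _ := GRing.isMonoidMorphism.Build _ _ cemb cemb_monoid.

Lemma cdv_emb c : c != 0 -> cdv (cemb c) = v c.
Proof.
move=> c0; apply: (@cdv_uniq _ _ 0%N) => [|n _]; last by rewrite cst_seqE.
by rewrite -/(cemb c) (fmorph_eq0 cemb).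
Qed.

Lemma cdv_surj (m : int) : exists2 x : cfield, x != 0 & cdv x = m.
Proof.
have [x x0 xm] := dv_surj v m.
by exists (cemb x); rewrite ?(fmorph_eq0 cemb)// cdv_emb.
Qed.

Definition cdvdv : discrete_valuation cfield :=
  DiscreteValuation cdvM cdvD cdv_surj.

Lemma cdv_small_seq N (s : cauchy_seq) (n0 : nat) :
  (forall n, (n0 <= n)%N -> dv_small v N (val s n)) ->
  dv_small cdvdv N (cpi s).
Proof.
move=> sN; have [->|s0] := eqVneq (cpi s) 0; first by left.
have [n1 h1] := cdvP s0; right.
have [a0 /= <-] := h1 (maxn n0 n1) (leq_maxr _ _).
by have := sN (maxn n0 n1) (leq_maxl _ _); rewrite dv_smallE.
Qed.

Lemma cpi_approx (s : cauchy_seq) N : exists n0 : nat, forall n, (n0 <= n)%N ->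
  dv_small cdvdv N (cemb (val s n) - cpi s).
Proof.
have [n0 h0] := cseqP s N; exists n0 => n n0n.
rewrite -[cemb _]/(cpi (cst_seq _)) -rmorphB.
apply: (@cdv_small_seq _ _ n0) => k n0k; rewrite rmorphB/= -!/(val _) cst_seqE.
exact: h0.
Qed.

Lemma cemb_dense : dense (range cemb : set (adic cdvdv)).
Proof.
move=> O [x Ox] oO; have /adic_nbhsP[N NO] : nbhs x O.
  by rewrite nbhsE; exists O.
have [n0 h0] := cpi_approx (crepr x) N.
exists (cemb (val (crepr x) n0)); split; last by exists (val (crepr x) n0).
by apply: NO; have := h0 _ (leqnn n0); rewrite creprK.
Qed.

(** For each precision [N], a ball belonging to [G] is recentred at some [a N] in [K]. The sequence
    [a] is Cauchy for [v], and its class is the limit of [G]. *)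
Lemma cfield_complete (G : set_system (adic cdvdv)) :
  ProperFilter G -> cauchy G -> cvg G.
Proof.
move=> PG cG.
have GN (N : nat) : exists x : adic cdvdv,
    G [set y : adic cdvdv | dv_small cdvdv N%:Z ((y : cfield) - (x : cfield))].
  have : entourage [set xy : adic cdvdv * adic cdvdv |
      dv_small cdvdv N%:Z ((xy.2 : cfield) - (xy.1 : cfield))].
    by exists N%:Z.
  move=> /cG [[A B] /= [GA GB] AB]; have [x Ax] := filter_ex GA.
  exists x; apply: filterS GB => y By.
  exact: (AB (x, y)).
have [xs xsP] := choice GN.
have approx (N : nat) : exists c, dv_small cdvdv N%:Z (cemb c - (xs N : cfield)).
  have [n0 h0] := cpi_approx (crepr (xs N)) N%:Z.
  by exists (val (crepr (xs N)) n0); have := h0 _ (leqnn n0); rewrite creprK.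
have [a aP] := choice approx.
have aG (N : nat) : G [set y : adic cdvdv |
    dv_small cdvdv N%:Z ((y : cfield) - cemb (a N))].
  apply: filterS (xsP N) => y /= yN.
  by rewrite -[X in _ - X](subrK (xs N : cfield)) opprD addrA addrAC;
    exact: dv_smallB.
(* Two members of [G] intersect; a common point compares [a M] with [a N]. *)
have aa (M N : nat) : (M <= N)%N -> dv_small v M%:Z (a N - a M).
  move=> MN; have [y [yM yN]] := filter_ex (filterI (aG M) (aG N)).
  have : dv_small cdvdv M%:Z (cemb (a N - a M)).
    rewrite rmorphB -[X in X - _](subrK (y : cfield)) -addrA.
    apply: dv_smallD => //; rewrite -opprB; apply: dv_smallN.
    by apply: dv_small_le yN; rewrite lez_nat.
  have [->|d0] := eqVneq (a N - a M) 0; first by left.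
  by rewrite !dv_smallE ?(fmorph_eq0 cemb)//= cdv_emb.
have ca : dv_cauchy a.
  move=> N; exists `|N|%N => m n Nm Nn.
  apply: (@dv_small_le _ _ _ `|N|%N%:Z); first exact: lez_abs.
  rewrite -(subrKA (a `|N|%N)); apply: dv_smallD; first exact: aa.
  by rewrite -opprB; apply: dv_smallN; exact: aa.
pose s : cauchy_seq := insubd 0 a.
have sE : val s = a by rewrite insubdK//; exact/cauchy_predP.
apply/cvg_ex; exists (cpi s : adic cdvdv) => A /adic_nbhsP[N NA].
have [n0 h0] := cpi_approx s N.
apply: filterS (aG (maxn n0 `|N|%N)) => y /= yN; apply: NA.
rewrite -(subrKA (cemb (a (maxn n0 `|N|%N)))); apply: dv_smallD.
  apply: dv_small_le yN; apply: (le_trans (lez_abs N)).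
  by rewrite lez_nat leq_maxr.
by rewrite -sE; apply: h0; rewrite leq_maxl.
Qed.

(** The local condition ranges over all completions at [v]; this one ensures that it says something
    at every [v]. *)
Definition cauchy_completion : completion v :=
  @Completion K v cfield cdvdv cemb cdv_emb cemb_dense cfield_complete.

End completion_existence.

(** * Prime ideals and discrete valuations *)

Definition is_subring (K : comNzRingType) (A : set K) : Prop :=
  [/\ A 1, forall x y, A x -> A y -> A (x - y)
    & forall x y, A x -> A y -> A (x * y)].

Definition is_ideal (K : comNzRingType) (A I : set K) : Prop :=
  [/\ I `<=` A, I 0, forall x y, I x -> I y -> I (x + y)
    & forall a x, A a -> I x -> I (a * x)].

Section subrings.
Variables (K : comNzRingType) (A : set K).
Hypothesis A_ring : is_subring A.

Lemma subring1 : A 1. Proof. by case: A_ring. Qed.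

Lemma subringB x y : A x -> A y -> A (x - y).
Proof. by case: A_ring => _ + _; apply. Qed.

Lemma subringM x y : A x -> A y -> A (x * y).
Proof. by case: A_ring => _ _; apply. Qed.

Lemma subring0 : A 0.
Proof. by rewrite -(subrr 1); apply: subringB; exact: subring1. Qed.

Lemma subringN x : A x -> A (- x).
Proof. by rewrite -sub0r; apply: subringB; exact: subring0. Qed.

Lemma subringD x y : A x -> A y -> A (x + y).
Proof. by move=> Ax Ay; rewrite -(opprK y); apply/subringB/subringN. Qed.

Lemma subringX x n : A x -> A (x ^+ n).
Proof.
move=> Ax; elim: n => [|n IH]; first exact: subring1.
by rewrite exprS; exact: subringM.
Qed.

Lemma subring_sum (I : Type) (s : seq I) (P : pred I) (f : I -> K) :
  (forall i, P i -> A (f i)) -> A (\sum_(i <- s | P i) f i).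
Proof.
by move=> Af; elim/big_ind : _ => //; [exact: subring0|exact: subringD].
Qed.

Lemma subring_prod (I : Type) (s : seq I) (P : pred I) (f : I -> K) :
  (forall i, P i -> A (f i)) -> A (\prod_(i <- s | P i) f i).
Proof.
by move=> Af; elim/big_ind : _ => //; [exact: subring1|exact: subringM].
Qed.

(** Zorn's lemma is applied to the sets [X] whose union with [I] is a proper ideal, rather than to
    the ideals themselves, so that the empty chain causes no exception. *)
Lemma ideal_maximal I : is_ideal A I -> ~ I 1 -> exists M,
  [/\ is_ideal A M, I `<=` M, ~ M 1
    & forall x, A x -> ~ M x -> exists m a, [/\ M m, A a & 1 = m + a * x]].
Proof.
move=> [IA I0 ID IM] I1.
pose P X := is_ideal A (I `|` X) /\ ~ (I `|` X) 1.
have [F FP Ftot|X [[[XA X0 XD XM] X1] Xmax]] := @Zorn_bigcup K P.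
  split; last by case=> // -[X /FP[_ X1] ?]; apply: X1; right.
  split.
  - move=> x [/IA//|[X /FP[[XA _ _ _] _] Xx]].
    by apply: XA; right.
  - by left.
  (* A sum of elements of two members of the chain is formed inside the larger one. *)
  - have UF X Y x y : F X -> F Y -> X `<=` Y -> (I `|` X) x ->
        (I `|` Y) y -> (I `|` \bigcup_(Z in F) Z) (x + y).
      move=> FX FY XY Xx Yy; have [[_ _ YD _] _] := FP _ FY.
      have [|?|?] := YD x y _ Yy; last 2 first.
      + by left.
      + by right; exists Y.
      + by case: Xx => [?|/XY ?]; [left|right].
    move=> x y [Ix|[X FX Xx]] [Iy|[Y FY Yy]].
    + by left; exact: ID.
    + by apply: (UF Y Y) => //; [left|right].
    + by apply: (UF X X) => //; [right|left].
    + case: (Ftot _ _ FX FY) => [XY|YX].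
        by apply: (UF X Y) => //; right.
      by rewrite addrC; apply: (UF Y X) => //; right.
  - move=> a x Aa [Ix|[X FX Xx]]; first by left; exact: IM.
    have [[_ _ _ XM] _] := FP _ FX.
    have [|?|?] := XM a x Aa; first by right.
      by left.
    by right; exists X.
exists (I `|` X); split => //.
move=> x Ax Xx; apply: contrapT => Nx.
(* The ideal generated by the maximal candidate and [x]; if it missed 1, it would be a strictly
   larger candidate. *)
pose Y := [set y | exists m a, [/\ (I `|` X) m, A a & y = m + a * x]].
have IY : I `|` X `<=` Y.
  move=> y Xy; exists y, 0; split; rewrite ?mul0r ?addr0//.
  exact: subring0.
apply: (Xmax Y).
  rewrite properEneq; split; last by move=> y Xy; apply: IY; right.
  apply/eqP => XY; apply: Xx; right; rewrite XY; exists 0, 1.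
  by rewrite add0r mul1r; split => //; exact: subring1.
rewrite /P; have -> : I `|` Y = Y.
  by apply/setUidPr => y Iy; apply: IY; left.
split; last by move=> [m [a [? ? ?]]]; apply: Nx; exists m, a.
split.
- move=> _ [m [a [/XA Am Aa ->]]].
  by apply: subringD => //; exact: subringM.
- by apply: IY; left.
- move=> _ _ [m [a [Mm Aa ->]]] [m' [a' [Mm' Aa' ->]]].
  exists (m + m'), (a + a'); split; [exact: XD|exact: subringD|].
  by rewrite mulrDl addrACA.
- move=> b _ Ab [m [a [Mm Aa ->]]].
  exists (b * m), (b * a); split; [exact: XM|exact: subringM|].
  by rewrite mulrDr mulrA.
Qed.

Lemma ideal_prime I : is_ideal A I -> ~ I 1 -> exists M,
  [/\ is_ideal A M, I `<=` M, ~ M 1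
    & forall x y, A x -> A y -> M (x * y) -> M x \/ M y].
Proof.
move=> Ii I1; have [M [Mi IM M1 Mmax]] := ideal_maximal Ii I1.
exists M; split => // x y Ax Ay Mxy; have [|Mx] := pselect (M x); first by left.
right; have [m [a [Mm Aa m1]]] := Mmax x Ax Mx.
have [_ _ MD MM] := Mi; rewrite -[y]mulr1 m1 mulrDr.
by apply: MD; [exact: MM|rewrite mulrCA (mulrC y); exact: MM].
Qed.

End subrings.

(** * From a valuation ring to a discrete valuation *)

Section discrete_valuation_of_ring.
Variables (K : fieldType) (O : set K) (p : K) (E : nat).
Hypothesis O_ring : is_subring O.
Hypothesis O_total : forall x, x != 0 -> O x \/ O x^-1.
Hypotheses (p0 : p != 0) (Op : O p) (NOp : ~ O p^-1).
Hypothesis E_gt0 : (0 < E)%N.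

Definition Ounit x := O x /\ O x^-1.

Lemma Ounit1 : Ounit 1.
Proof. by split; rewrite ?invr1; exact: subring1. Qed.

Lemma OunitM x y : Ounit x -> Ounit y -> Ounit (x * y).
Proof. by move=> [? ?] [? ?]; split; rewrite ?invfM; exact: subringM. Qed.

Lemma OunitV x : Ounit x -> Ounit x^-1.
Proof. by move=> [? ?]; split; rewrite ?invrK. Qed.

Lemma OunitX x n : Ounit x -> Ounit (x ^+ n).
Proof.
move=> Ux; elim: n => [|n IH]; first exact: Ounit1.
by rewrite exprS; exact: OunitM.
Qed.

Lemma Opz (a : int) : O (p ^ a) <-> 0 <= a.
Proof.
split; last by case: a => // n _; exact: subringX.
case: a => // n; rewrite NegzE -exprnN => Opn; exfalso; apply: NOp.
have -> : p^-1 = p ^- n.+1 * p ^+ n.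
  by rewrite exprS invfM -mulrA mulVf ?mulr1// expf_neq0.
by apply: subringM => //; exact: subringX.
Qed.

(** Divisibility in a valuation ring is a total preorder, so a finite family has a member dividing
    all the others. *)
Lemma O_dominant (I : eqType) (z : I -> K) (s : seq I) :
  has (fun i => z i != 0) s -> exists i, [/\ i \in s, z i != 0 &
    forall j, j \in s -> O (z j / z i)].
Proof.
elim: s => // a s IH /=; have [za0 /= /IH|za0 _] := eqVneq (z a) 0.
  move=> [i [si zi0 iO]]; exists i; split => //; first by rewrite inE si orbT.
  move=> j; rewrite inE => /predU1P[->|]; last exact: iO.
  by rewrite za0 mul0r; exact: subring0.
have [/IH[i [si zi0 iO]]|/hasPn s0] := boolP (has (fun i => z i != 0) s).
  have [|Oai|] := @O_total (z a / z i); first by rewrite mulf_neq0 ?invr_eq0.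
    exists i; split => //; first by rewrite inE si orbT.
    by move=> j; rewrite inE => /predU1P[->//|]; exact: iO.
  rewrite invf_div => Oia; exists a; split => //; first by rewrite inE eqxx.
  move=> j; rewrite inE => /predU1P[->|/iO Oji].
    by rewrite divff//; exact: subring1.
  have -> : z j / z a = (z j / z i) * (z i / z a) by rewrite mulrA divfK.
  exact: subringM.
exists a; split => //; first by rewrite inE eqxx.
move=> j; rewrite inE => /predU1P[->|/s0].
  by rewrite divff//; exact: subring1.
by rewrite negbK => /eqP ->; rewrite mul0r; exact: subring0.
Qed.

(* In a vanishing sum the two largest terms have the same valuation. *)
Lemma O_sum0 (I : finType) (z : I -> K) (i0 : I) : z i0 != 0 ->
  \sum_i z i = 0 -> exists i j, [/\ i != j, z i != 0, z j != 0 &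
    Ounit (z i / z j)].
Proof.
move=> zi0 z_sum.
have [|j [_ zj0 jO]] := @O_dominant _ z (enum I).
  by apply/hasP; exists i0; rewrite ?mem_enum.
have zjE : z j = - \sum_(i | i != j) z i.
  by move: z_sum; rewrite (bigD1 j)//= => /eqP; rewrite addr_eq0 => /eqP.
have [|i [+ zi iO]] := @O_dominant _ z [seq i <- enum I | i != j].
  apply/negPn/negP => /hasPn nz; move: zj0; rewrite zjE big1 ?oppr0 ?eqxx//.
  move=> i ij; apply/eqP; have := nz i.
  by rewrite mem_filter ij mem_enum/= negbK; apply.
rewrite mem_filter => /andP[ij _]; exists i, j; split => //; split.
  by apply: jO; rewrite mem_enum.
rewrite invf_div {1}zjE mulNr mulr_suml; apply: subringN => //.
by apply: subring_sum => // l lj; apply: iO; rewrite mem_filter lj mem_enum.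
Qed.

Hypothesis p_power : forall x, x != 0 -> exists a : int, Ounit (x ^+ E / p ^ a).

(** If 1/x is in [O], then x = x^E (1/x)^(E-1) brings [x] back into [O]. *)
Lemma O_root x : x != 0 -> O (x ^+ E) -> O x.
Proof.
move=> x0 OE; case: (O_total x0) => // OV.
have -> : x = x ^+ E * x^-1 ^+ E.-1.
  case: (E) E_gt0 => // n _; rewrite exprVn exprS -mulrA mulfV ?mulr1//.
  by rewrite expf_neq0.
by apply: subringM => //; exact: subringX.
Qed.

(** The exponent [f x] for which x^E is a unit times p^(f x) is a homomorphism to the integers,
    nonnegative exactly on [O]. Its image is generated by its least positive value; dividing by that
    value makes it surjective. *)
Lemma exists_discrete_valuation : exists w : discrete_valuation K,
  forall x, x != 0 -> (0 <= w x <-> O x).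
Proof.
have /choice[f fP] : forall x, exists a : int,
    x != 0 -> Ounit (x ^+ E / p ^ a).
  move=> x; have [->|/p_power[a ?]] := eqVneq x 0; first by exists 0.
  by exists a.
have pz0 (a : int) : p ^ a != 0 by exact: expfz_neq0.
have f_ge0 x : x != 0 -> 0 <= f x <-> O x.
  move=> x0; have [U1 U2] := fP x x0; split.
    move=> /Opz Opf; apply: O_root => //.
    by rewrite -[X in O X](divfK (pz0 (f x))); exact: subringM.
  move=> Ox; apply/Opz.
  have -> : p ^ f x = (x ^+ E / p ^ f x)^-1 * x ^+ E.
    by rewrite invf_div divfK// expf_neq0.
  by apply: subringM => //; exact: subringX.
have Upz a : Ounit (p ^ a) -> a = 0.
  move=> [/Opz a0]; rewrite invr_expz => /Opz; rewrite oppr_ge0 => a1.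
  by apply/eqP; rewrite eq_le a0 a1.
have fM x y : x != 0 -> y != 0 -> f (x * y) = f x + f y.
  move=> x0 y0; apply/eqP; rewrite -subr_eq0; apply/eqP/Upz.
  have xy0 : x * y != 0 by rewrite mulf_neq0.
  (* The units attached to [x] and [y] and the inverse of the one attached to [x * y] multiply to
     p^(f(xy) - f(x) - f(y)). *)
  have := OunitM (OunitM (fP x x0) (fP y y0)) (OunitV (fP _ xy0)).
  rewrite invf_div.
  rewrite [X in Ounit X](_ : _ = p ^ (f (x * y) - (f x + f y)))//.
  rewrite !expfzDr// -invr_expz expfzDr// exprMn; field.
  by rewrite !pz0 !expf_neq0.
have fV x : x != 0 -> f x^-1 = - f x.
  move=> x0; have xV0 : x^-1 != 0 by rewrite invr_eq0.
  apply/eqP; rewrite -addr_eq0 -fM// mulVf//.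
  by rewrite -(addrK (f 1) (f 1)) -fM ?oner_eq0// mulr1 subrr.
have fD x y : x != 0 -> y != 0 -> x + y != 0 -> f x <= f y -> f x <= f (x + y).
  move=> x0 y0 xy0 xy.
  have Oyx : O (y / x).
    by apply/f_ge0; rewrite ?fM ?fV ?mulf_neq0 ?invr_eq0// subr_ge0.
  rewrite -subr_ge0 -fV// -fM ?invr_eq0//; apply/f_ge0.
    by rewrite mulf_neq0// invr_eq0.
  by rewrite mulrDl divff//; apply: subringD => //; exact: subring1.
have f1 : f 1 = 0 by apply: (addrI (f 1)); rewrite -fM ?oner_eq0// mulr1 addr0.
have fp : 0 < f p.
  rewrite lt_neqAle eq_sym; apply/andP; split; last exact/f_ge0.
  apply/eqP => fp0; apply: NOp; apply/f_ge0; rewrite ?invr_eq0//.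
  by rewrite fV// fp0.
have fX x (n : nat) : x != 0 -> f (x ^+ n) = f x * n%:Z.
  move=> x0; elim: n => [|n IH]; first by rewrite mulr0.
  by rewrite exprS fM ?expf_neq0// IH intS mulrDr mulr1.
have fXz x a : x != 0 -> f (x ^ a) = f x * a.
  move=> x0; case: a => [n|n]; first exact: fX.
  by rewrite NegzE -exprnN fV ?expf_neq0// fX// mulrN.
(* A uniformizer; positive values exist since [f p] is one. *)
have [pi [pi0 fpi pi_min]] : exists x, [/\ x != 0, 0 < f x &
    forall y, y != 0 -> 0 < f y -> f x <= f y].
  have exf : exists n, `[< exists x, [/\ x != 0, 0 < f x & f x = n%:Z] >].
    by exists `|f p|%N; apply/asboolP; exists p; split=> //; rewrite gtz0_abs.
  case: (ex_minnP exf) => n /asboolP[x [x0 fx0 fxn]] nmin.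
  exists x; split => // y y0 fy0; rewrite fxn -(gtz0_abs fy0) lez_nat.
  by apply: nmin; apply/asboolP; exists y; split=> //; rewrite gtz0_abs.
have fpi0 : f pi != 0 by rewrite gt_eqF.
(* The remainder of [f x] modulo [f pi] is itself a value of [f], so minimality of [pi] forces it to
   be 0. *)
have fdiv x : x != 0 -> f x = (f x %/ f pi)%Z * f pi.
  move=> x0; apply/eqP; rewrite eq_sym -dvdz_eq; apply/dvdz_mod0P/eqP.
  have := modz_ge0 (f x) fpi0; rewrite le_eqVlt eq_sym => /predU1P[->//|m0].
  have mE : (f x %% f pi)%Z = f (x * pi ^ (- (f x %/ f pi)%Z)).
    by rewrite fM ?expfz_neq0// fXz// mulrN (mulrC (f pi)).
  have := ltz_pmod (f x) fpi; rewrite ltNge mE pi_min//.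
  - by rewrite mulf_neq0// expfz_neq0.
  - by rewrite -mE.
have wM x y : x != 0 -> y != 0 ->
    (f (x * y) %/ f pi)%Z = (f x %/ f pi)%Z + (f y %/ f pi)%Z.
  move=> x0 y0; apply: (mulIf fpi0); rewrite mulrDl -!fdiv ?mulf_neq0//.
  exact: fM.
have wD x y : x != 0 -> y != 0 -> x + y != 0 ->
    Num.min (f x %/ f pi)%Z (f y %/ f pi)%Z <= (f (x + y) %/ f pi)%Z.
  move=> x0 y0 xy0; rewrite ge_min.
  have [xy|/ltW yx] := leP (f x) (f y); apply/orP; [left|right].
    by apply: lez_pdiv2r; [exact: ltW|exact: fD].
  by apply: lez_pdiv2r; [exact: ltW|rewrite addrC; apply: fD; rewrite // addrC].
have wS m : exists2 x, x != 0 & (f x %/ f pi)%Z = m.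
  by exists (pi ^ m); rewrite ?expfz_neq0// fXz// mulKz.
exists (DiscreteValuation wM wD wS) => x x0 /=; rewrite -f_ge0//.
by rewrite [in X in _ <-> X](fdiv _ x0) pmulr_lge0.
Qed.

End discrete_valuation_of_ring.

(** * Integral solutions from local ones *)

Section linear_form.
Variables (F : fieldType) (r : nat).
Implicit Types a x y : 'rV[F]_r.

Lemma linear_formD a x y :
  linear_form a (x + y) = linear_form a x + linear_form a y.
Proof.
by rewrite /linear_form -big_split; apply: eq_bigr => j _; rewrite mxE mulrDr.
Qed.

Lemma linear_formZ a c x : linear_form a (c *: x) = c * linear_form a x.
Proof.
rewrite /linear_form big_distrr; apply: eq_bigr => j _.
by rewrite mxE mulrCA.
Qed.

Lemma linear_formB a x y :
  linear_form a (x - y) = linear_form a x - linear_form a y.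
Proof. by rewrite linear_formD -scaleN1r linear_formZ mulN1r. Qed.

Lemma linear_form0 a : linear_form a 0 = 0.
Proof. by rewrite -(subrr 0) linear_formB subrr. Qed.

End linear_form.

(** * The integral closure of an embedded polynomial ring *)

Section integral_closure.
Variables (k K : fieldType) (phi : {rmorphism {poly k} -> K}) (d : nat).
Hypothesis phi_inj : injective phi.
Hypothesis phi_alg : forall x : K, exists q : {poly {poly k}},
  [/\ q != 0, (size q <= d.+1)%N & root (map_poly phi q) x].

Local Notation A := ([set x | integralOver phi x] : set K).

Lemma integral_subring : is_subring A.
Proof.
split => [|x y|x y] /=; first exact: integral1.
  exact: integral_sub.
exact: integral_mul.
Qed.

Let A1 : A 1 := subring1 integral_subring.
Let A_phi f : A (phi f). Proof. exact: integral_id. Qed.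

Lemma phi_eq0 f : (phi f == 0) = (f == 0).
Proof. by rewrite -(inj_eq phi_inj) rmorph0. Qed.

(** With c the coefficient of degree e > 0, multiplying the equation by c^(e-1) makes it monic in c
    x, with lower coefficients q_i c^(e-1-i). *)
Lemma integral_lead (q : {poly K}) (e : nat) x :
  (forall i, A q`_i) -> (size q <= e.+1)%N -> root q x -> A (q`_e * x).
Proof.
move=> qA; case: e => [|e] sq.
  rewrite (size1_polyC sq) rootC coefC/= => /eqP ->.
  by rewrite mul0r; exact: subring0 integral_subring.
set c := q`_e.+1; rewrite rootE (horner_coef_wide _ sq) => /eqP qx0.
pose p := \poly_(i < e.+2) (if i == e.+1 then 1 else q`_i * c ^+ (e - i)).
have p_lead : (if e.+1 == e.+1 then 1 else q`_e.+1 * c ^+ (e - e.+1)) != 0.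
  by rewrite eqxx oner_eq0.
apply: (@integral_root_monic _ _ phi _ p).
- by apply/monicP; rewrite lead_coef_poly// eqxx.
- rewrite rootE horner_poly; apply/eqP.
  transitivity (c ^+ e * \sum_(i < e.+2) q`_i * x ^+ i); last first.
    by rewrite qx0 mulr0.
  rewrite big_distrr; apply: eq_bigr => i _ /=.
  case: eqVneq => [->|ie]; first by rewrite mul1r exprMn exprSr -!mulrA.
  have ei : (i <= e)%N by rewrite -ltnS ltn_neqAle ie -ltnS ltn_ord.
  have -> : c ^+ e = c ^+ (e - i) * c ^+ i by rewrite -exprD subnK.
  by rewrite exprMn; ring.
- move=> _ /(nthP 0)[i _ <-]; rewrite coef_poly.
  case: ifP => _; last exact: subring0 integral_subring.
  case: ifP => _; first exact: A1.
  apply: (subringM integral_subring); first exact: qA.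
  by apply: (subringX integral_subring); exact: qA.
Qed.

Lemma integral_denom y : exists c, [/\ c != 0, A c & A (c * y)].
Proof.
have [q [q0 _ qy]] := phi_alg y.
exists (phi (lead_coef q)); split.
- by rewrite phi_eq0 lead_coef_eq0.
- exact: A_phi.
rewrite -[phi _](coef_map phi q); apply: integral_lead => //.
- by move=> i; rewrite coef_map; exact: A_phi.
- exact: leq_trans (size_poly _ _) (leqSpred _).
Qed.

(** * The place attached to a nonzero prime ideal *)

Section prime.
Variable M : set K.
Hypothesis M_ideal : is_ideal A M.
Hypothesis M1 : ~ M 1.
Hypothesis M_prime : forall x y, A x -> A y -> M (x * y) -> M x \/ M y.

Let MA x : M x -> A x. Proof. by case: M_ideal => + _ _ _; exact. Qed.
Let M0 : M 0. Proof. by case: M_ideal. Qed.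
Let MD x y : M x -> M y -> M (x + y).
Proof. by case: M_ideal => _ _ + _; exact. Qed.
Let MM a x : A a -> M x -> M (a * x).
Proof. by case: M_ideal => _ _ _; exact. Qed.
Let MB x y : M x -> M y -> M (x - y).
Proof.
move=> Mx My; apply: MD => //; rewrite -mulN1r; apply: MM => //.
exact: (subringN integral_subring).
Qed.

(* Either [x] or its inverse lies in the localization of [A] at [M]: the top
   coefficient [c] of an equation of degree [e.+1] for [x] makes [c * x]
   integral, and if both [c] and [c * x] are in [M] then [c * x] can be merged
   into the next coefficient. *)
Lemma prime_localization (e : nat) (q : {poly K}) x :
  (forall i, A q`_i) -> (size q <= e.+1)%N -> root q x ->
  (exists i, ~ M q`_i) ->
  (exists s, [/\ A s, ~ M s & A (s * x)]) \/
  (exists s, [/\ A s, A (s * x) & ~ M (s * x)]).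
Proof.
elim: e q => [|e IH] q qA sq qx [i0 Mi0].
  exfalso; apply: Mi0; move: qx; rewrite (size1_polyC sq) rootC => /eqP ->.
  by rewrite coefC; case: ifP.
have Ac := qA e.+1; set c := q`_e.+1 in Ac *.
have Acx : A (c * x) by exact: integral_lead.
have [Mc|Mc] := pselect (M c); last by left; exists c.
have [Mcx|Mcx] := pselect (M (c * x)); last by right; exists c.
have q'E i : (q - c *: 'X^(e.+1) + (c * x) *: 'X^e)`_i =
    q`_i - c * (i == e.+1)%:R + c * x * (i == e)%:R.
  by rewrite !(coefD, coefN, coefZ, coefXn).
apply: (IH (q - c *: 'X^(e.+1) + (c * x) *: 'X^e)).
- move=> i; rewrite q'E; apply: (subringD integral_subring).
    apply: (subringB integral_subring); first exact: qA.
    by case: eqP => _; rewrite ?mulr1 ?mulr0//; exact: subring0 integral_subring.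
  by case: eqP => _; rewrite ?mulr1 ?mulr0//; exact: subring0 integral_subring.
- apply/leq_sizeP => j ej; rewrite q'E (gtn_eqF ej) mulr0 addr0.
  move: ej; rewrite leq_eqVlt => /predU1P[<-|ej].
    by rewrite eqxx mulr1 subrr.
  by rewrite (gtn_eqF ej) mulr0 subr0; apply/leq_sizeP: ej.
- rewrite rootE !hornerE; move/rootP: qx => ->.
  by rewrite exprS mulrA; apply/eqP; ring.
- exists i0; rewrite q'E => Mq; apply: Mi0.
  have [->|i0e1] := eqVneq i0 e.+1; first exact: Mc.
  move: Mq; rewrite (negPf i0e1) mulr0 subr0; have [->|i0e] := eqVneq i0 e.
    by rewrite mulr1 => /MB /(_ Mcx); rewrite addrK.
  by rewrite mulr0 addr0.
Qed.

Hypothesis M_neq0 : exists2 y, M y & y != 0.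

(** After powers of the variable are cancelled, an equation of [y] has a nonzero constant term,
    which is a multiple of [y] in [A]. *)
Lemma prime_contract_neq0 : exists2 f, f != 0 & M (phi f).
Proof.
have [y My y0] := M_neq0; have [q [+ _]] := phi_alg y.
elim/poly_ind: q => [|q c IH]; first by rewrite eqxx.
have [->|c0] := eqVneq c 0.
  rewrite addr0 mulf_eq0 polyX_eq0 orbF => /IH{}IH.
  rewrite rmorphM/= map_polyX rootM rootX (negPf y0) orbF.
  exact: IH.
move=> _; rewrite rmorphD rmorphM/= map_polyX map_polyC rootE !hornerE => /eqP.
move=> /eqP; rewrite addrC addr_eq0 => /eqP cE.
exists c => //; rewrite cE -mulNr; apply: MM => //.
apply: (subringN integral_subring); rewrite horner_coef.
apply: (subring_sum integral_subring) => i _.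
rewrite coef_map; apply: (subringM integral_subring); first exact: A_phi.
by apply: (subringX integral_subring); exact: MA.
Qed.

(** The contraction of [M] to k[t] is principal, generated by a nonzero member of least degree; it
    is not constant because [M] is proper. *)
Lemma prime_contract_generator : exists p, [/\ p != 0, M (phi p),
  (1 < size p)%N & forall f, M (phi f) -> p %| f].
Proof.
have [f0 f00 Mf0] := prime_contract_neq0.
have exn : exists n, `[< exists f, [/\ f != 0, M (phi f) & size f = n] >].
  by exists (size f0); apply/asboolP; exists f0.
case: (ex_minnP exn) => n /asboolP[p [p0 Mp <-]] pmin.
exists p; split => //.
- rewrite ltnNge; apply/negP => sp; apply: M1.
  have pE := size1_polyC sp; have c0 : p`_0 != 0.
    by apply: contraNneq p0 => c0; rewrite pE c0 polyC0.
  rewrite -(rmorph1 phi) -[1]/(1%:P) -(mulVf c0) polyCM -pE rmorphM.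
  exact: MM.
- move=> f Mf; have [//|m0] := eqVneq (f %% p) 0; first by move/eqP.
  have := pmin (size (f %% p)); rewrite leqNgt ltn_modp p0 => H.
  have : false by apply: H; apply/asboolP; exists (f %% p); split => //;
    rewrite -(addKr (f %/ p * p) (f %% p)) -divp_eq addrC rmorphB rmorphM;
    apply: MB => //; exact: MM.
  by [].
Qed.

(** An equation with all coefficients in [M] can be divided by the generator [p]. Each division
    lowers the degree of the leading coefficient, so the process stops. *)
Lemma prime_relation x : exists q : {poly {poly k}},
  [/\ (size q <= d.+1)%N, root (map_poly phi q) x
    & exists i, ~ M (phi q`_i)].
Proof.
have [p [p0 Mp sp pdiv]] := prime_contract_generator.
have [q [q0 sq qx]] := phi_alg x.
have [n] := ubnP (size (lead_coef q)); elim: n q q0 sq qx => // n IH q q0 sq qx sn.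
have [[i qi]|/forallNP allM] := pselect (exists i, ~ M (phi q`_i)).
  by exists q; split => //; exists i.
pose q' := map_poly (fun f => f %/ p) q.
have qE : q = p *: q'.
  apply/polyP => i; rewrite coefZ coef_map_id0 ?div0p// mulrC divpK//.
  by apply: pdiv; exact: contrapT (allM i).
have q'0 : q' != 0 by apply: contraNneq q0 => q'0; rewrite qE q'0 scaler0.
apply: (IH q') => //.
- by rewrite qE size_scale in sq.
- by move: qx; rewrite qE map_polyZ rootZ// phi_eq0.
- move: sn; rewrite qE lead_coefZ size_mul ?lead_coef_eq0//.
  move: sp; case: (size p) => [|[|m]]// _.
  by rewrite !addSn/= ltnS; apply: leq_trans; rewrite ltnS leq_addl.
Qed.

Lemma prime_total x : (exists s, [/\ A s, ~ M s & A (s * x)]) \/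
  (exists s, [/\ A s, A (s * x) & ~ M (s * x)]).
Proof.
have [q [sq qx [i qi]]] := prime_relation x.
apply: (@prime_localization d (map_poly phi q)) => //.
- by move=> j; rewrite coef_map; exact: A_phi.
- exact: leq_trans (size_poly _ _) sq.
- by exists i; rewrite coef_map.
Qed.

Definition localization : set K := [set x | exists s, [/\ A s, ~ M s & A (s * x)]].

Let prime_mul s t : A s -> ~ M s -> A t -> ~ M t -> ~ M (s * t).
Proof. by move=> As Ms At Mt /M_prime[]. Qed.

Lemma localization_subring : is_subring localization.
Proof.
split.
- by exists 1; rewrite mulr1.
- move=> x y [s [As Ms Asx]] [t [At Mt Aty]]; exists (s * t); split.
  + exact: (subringM integral_subring).
  + exact: prime_mul.
  + rewrite mulrBr; apply: (subringB integral_subring).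
      by rewrite mulrAC; exact: (subringM integral_subring).
    by rewrite -mulrA; exact: (subringM integral_subring).
- move=> x y [s [As Ms Asx]] [t [At Mt Aty]]; exists (s * t); split.
  + exact: (subringM integral_subring).
  + exact: prime_mul.
  + by rewrite mulrACA; exact: (subringM integral_subring).
Qed.

Lemma localization_total x : x != 0 -> localization x \/ localization x^-1.
Proof.
move=> x0; case: (prime_total x) => [|[s [As Asx Msx]]]; [by left|right].
by exists (s * x); split => //; rewrite mulfK.
Qed.

Lemma localization_unit s : A s -> ~ M s -> Ounit localization s.
Proof.
move=> As Ms; split; first by exists 1; rewrite mul1r.
exists s; split => //; rewrite mulfV//.
by apply/eqP => s0; apply: Ms; rewrite s0.
Qed.

Lemma prime_place : exists w : discrete_valuation K,
  forall x, x != 0 -> (0 <= w x <-> localization x).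
Proof.
have [p [p0 Mp sp pdiv]] := prime_contract_generator.
have pp0 : phi p != 0 by rewrite phi_eq0.
have OR := localization_subring.
apply: (@exists_discrete_valuation K localization (phi p) d`!) => //.
- exact: localization_total.
- by exists 1; rewrite mul1r.
- by move=> [s [As Ms /MM/(_ Mp)]]; rewrite divfK.
- exact: fact_gt0.
(* [p] is divided out of [f] as long as [phi f] lies in [M]; what remains is a unit of the
   localization. *)
have poly_power f : f != 0 -> exists a : nat, Ounit localization (phi f / phi p ^+ a).
  have [n] := ubnP (size f); elim: n f => // n IH f sn f0.
  have [Mf|Mf] := pselect (M (phi f)); last first.
    by exists 0%N; rewrite divr1; exact: localization_unit.
  have fE := divpK (pdiv _ Mf); set g := f %/ p in fE.
  have g0 : g != 0 by apply: contraNneq f0 => g0; rewrite -fE g0 mul0r.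
  have [|//|a Ua] := IH g.
    move: sn; rewrite -fE size_mul//; move: sp; case: (size p) => [|[|m]]// _.
    by rewrite !addnS/= ltnS; apply: leq_trans; rewrite ltnS leq_addr.
  exists a.+1; rewrite -fE rmorphM exprSr.
  by rewrite -mulf_div divff// mulr1.
have pow_sub (x : K) (i j : nat) (a b : nat) : x != 0 -> (i < j)%N -> (j <= d)%N ->
    Ounit localization (x ^+ j / x ^+ i / (phi p ^+ a / phi p ^+ b)) ->
    exists c : int, Ounit localization (x ^+ d`! / phi p ^ c).
  move=> x0 ij jd U.
  have /dvdnP[e eE] : (j - i %| d`!)%N.
    by rewrite dvdn_fact// subn_gt0 ij (leq_trans (leq_subr _ _)).
  exists ((a%:Z - b%:Z) * e%:Z).
  have := OunitX OR e U; congr (Ounit _ _).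
  rewrite eE mulnC exprM (expfB_cond (m := j) (n := i))//; last first.
    by rewrite (negPf x0) ltnW.
  rewrite -exprz_exp -exprnP expfzDr// -exprnN -exprnP; exact: expr_div_n.
move=> x x0.
have [q [sq qx [i0 qi0]]] := prime_relation x.
pose z (i : 'I_(size q)) := phi q`_i * x ^+ i.
have i0q : (i0 < size q)%N.
  by rewrite ltnNge; apply/negP => /(nth_default 0) q0; apply: qi0; rewrite q0 rmorph0.
have zP i : z i != 0 -> q`_i != 0.
  by rewrite mulf_eq0 phi_eq0 negb_or => /andP[].
have [||i [j [ij zi zj U]]] := @O_sum0 _ _ OR localization_total _ z (Ordinal i0q).
- rewrite mulf_neq0 ?expf_neq0// phi_eq0; apply/eqP => q0.
  by apply: qi0; rewrite q0 rmorph0.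
- move: qx; rewrite rootE (@horner_coef_wide _ (size q)) ?size_poly// => /eqP qs.
  rewrite -[RHS]qs.
  by apply: eq_bigr => i _; rewrite coef_map.
have id' (l : 'I_(size q)) : (l <= d)%N by rewrite -ltnS (leq_trans (ltn_ord l)).
have [a Ua] := poly_power _ (zP _ zi); have [b Ub] := poly_power _ (zP _ zj).
have qi0' : phi q`_i != 0 by rewrite phi_eq0 zP.
have qj0' : phi q`_j != 0 by rewrite phi_eq0 zP.
(* The coefficients are traded for powers of [p], leaving only a quotient of powers of [x]. *)
have V : Ounit localization (x ^+ i / x ^+ j / (phi p ^+ b / phi p ^+ a)).
  have := OunitM OR (OunitM OR U (OunitV Ua)) Ub; rewrite /z.
  congr (Ounit _ _); field.
  by rewrite !expf_neq0 ?qi0' ?qj0'.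
have [iltj|jlti|/val_inj/eqP] := ltngtP i j; last by rewrite (negPf ij).
  apply: (@pow_sub x i j a b) => //.
  by have := OunitV V; congr (Ounit _ _); rewrite !invf_div; field; rewrite !expf_neq0.
exact: (@pow_sub x j i b a).
Qed.

End prime.

(** Multiplied by a power of X, a monic equation for 1/X becomes a polynomial identity whose value
    at 0 is 1 = 0. Hence X generates a proper ideal of [A], which will provide a first place. *)
Lemma not_integral_phiXV : ~ A (phi 'X)^-1.
Proof.
move=> [f f_monic]; rewrite rootE => /eqP fX.
have X0 : phi 'X != 0 by rewrite phi_eq0 polyX_eq0.
have /(congr1 (fun g => g.[0])) :
    \sum_(i < size f) f`_i * 'X^((size f).-1 - i) = 0 :> {poly k}.
  apply: phi_inj; rewrite rmorph0 -[RHS](mulr0 (phi 'X ^+ (size f).-1)) -fX.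
  rewrite (@horner_coef_wide _ (size f)) ?size_poly// big_distrr rmorph_sum.
  apply: eq_bigr => i _ /=; rewrite coef_map rmorphM rmorphXn/= mulrCA.
  congr (_ * _); rewrite exprVn; apply: expfB_cond.
  by rewrite (negPf X0) -ltnS prednK// (leq_ltn_trans _ (ltn_ord i)).
rewrite horner0 horner_sum.
have : (0 < size f)%N by rewrite size_poly_gt0 monic_neq0.
move: (monicP f_monic); rewrite lead_coefE; case: (size f) => // n /= fn _.
rewrite big_ord_recr/= fn subnn expr0 mulr1 hornerC big1 ?add0r.
  by move=> /eqP; rewrite oner_eq0.
move=> i _; rewrite hornerM hornerXn expr0n subn_eq0 leqNgt ltn_ord.
by rewrite mulr0.
Qed.

(** [T] is the complement in [A] of a prime ideal containing [I]: its elements avoid [I], yet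
    suffice as denominators for everything integral at [w]. *)
Lemma prime_place_sep (I : set K) : is_ideal A I -> ~ I 1 ->
  (exists2 y, I y & y != 0) ->
  exists (w : discrete_valuation K) (T : set K),
    [/\ T 1, forall s t, T s -> T t -> T (s * t), T `<=` A,
      forall s, T s -> ~ I s &
      forall x, x = 0 \/ 0 <= w x -> exists s, T s /\ A (s * x)].
Proof.
move=> I_ideal I1 [y Iy y0].
have [M [M_ideal IM M1 M_prime]] := ideal_prime integral_subring I_ideal I1.
have [|w wP] := prime_place M_ideal M1 M_prime; first by exists y => //; exact: IM.
exists w, [set s | A s /\ ~ M s]; split => //.
- move=> s t [As Ms] [At Mt]; split; last by case/M_prime.
  exact: (subringM integral_subring).
- by move=> s [].
- by move=> s [_ Ms] /IM.
- move=> x; have [->|x0] := eqVneq x 0.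
    by exists 1; rewrite mulr0; split => //; exact: subring0 integral_subring.
  move=> [/eqP|/(wP _ x0)[s [As Ms Asx]]]; first by rewrite (negPf x0).
  by exists s.
Qed.

Variables (n r : nat) (L : 'I_n -> 'rV[K]_r).

Hypothesis L_local : forall (w : discrete_valuation K) i, exists x,
  linear_form (L i) x != 0 /\ forall j, linear_form (L j) x != 0 ->
    w (linear_form (L i) x) <= w (linear_form (L j) x).

Lemma integral_solution i : exists x,
  linear_form (L i) x = 1 /\ forall j, A (linear_form (L j) x).
Proof.
have X0 : phi 'X != 0 by rewrite phi_eq0 polyX_eq0.
(* Some place is needed before [L_local] can show that [L i] does not vanish identically; the ideal
   generated by [phi 'X] yields one. *)
have [|||w0 _] := @prime_place_sep [set y | A (y / phi 'X)].
- split.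
  + move=> y /= Ay; rewrite -[y](divfK X0).
    by apply: (subringM integral_subring) => //; exact: A_phi.
  + by rewrite /= mul0r; exact: subring0 integral_subring.
  + by move=> x y /= Ax Ay; rewrite mulrDl; exact: (subringD integral_subring).
  + by move=> a x /= Aa Ax; rewrite -mulrA; exact: (subringM integral_subring).
- by rewrite /= mul1r; exact: not_integral_phiXV.
- by exists (phi 'X) => //=; rewrite divff.
pose I := [set a | A a /\ exists x, linear_form (L i) x = a /\
  forall j, A (linear_form (L j) x)].
suff [_] : I 1 by [].
apply: contrapT => I1.
have [w [T [T1 TM TA TI Tw]]] : exists (w : discrete_valuation K) (T : set K),
    [/\ T 1, forall s t, T s -> T t -> T (s * t), T `<=` A,
      forall s, T s -> ~ I s &
      forall x, x = 0 \/ 0 <= w x -> exists s, T s /\ A (s * x)].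
  apply: prime_place_sep => //.
    split; first by move=> a [].
    - split; first exact: subring0 integral_subring.
      exists 0; split => [|j]; rewrite linear_form0//.
      exact: subring0 integral_subring.
    - move=> a b [Aa [x [xa Ax]]] [Ab [y [yb Ay]]]; split.
        exact: (subringD integral_subring).
      exists (x + y); split => [|j]; rewrite linear_formD ?xa ?yb//.
      exact: (subringD integral_subring).
    - move=> a b Aa [Ab [y [yb Ay]]]; split.
        exact: (subringM integral_subring).
      exists (a *: y); split => [|j]; rewrite linear_formZ ?yb//.
      exact: (subringM integral_subring).
  (* Clearing the denominators of all the [L j x] gives a nonzero element of [I]. *)
  have [x [x0 _]] := L_local w0 i.
  have /choice[c cP] j := integral_denom (linear_form (L j) x).
  have c0 : \prod_j c j != 0.
    by apply/prodf_neq0 => j _; have [] := cP j.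
  have Ac j : A ((\prod_j c j) * linear_form (L j) x).
    rewrite (bigD1 j)//= mulrAC; apply: (subringM integral_subring).
      by have [] := cP j.
    apply: (subring_prod integral_subring) => l _.
    by have [] := cP l.
  exists ((\prod_j c j) * linear_form (L i) x); last by rewrite mulf_neq0.
  split => //; exists ((\prod_j c j) *: x); split => [|j]; rewrite linear_formZ//.
(* Scaled so that [L i] takes the value 1, the minimal point has all its [L j] integral at [w]. A
   product of denominators from [T] then lies in [I], which is excluded. *)
have [x [x0 xmin]] := L_local w i.
pose y := (linear_form (L i) x)^-1 *: x.
have yi : linear_form (L i) y = 1 by rewrite linear_formZ mulVf.
have /choice[s sP] j : exists s, T s /\ A (s * linear_form (L j) y).
  apply: Tw; rewrite linear_formZ.
  have [->|xj0] := eqVneq (linear_form (L j) x) 0; first by left; rewrite mulr0.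
  right; rewrite dvM ?invr_eq0// dvV// addrC subr_ge0.
  exact: xmin.
have Ts : T (\prod_j s j).
  by elim/big_ind : _ => // j _; have [] := sP j.
apply: (TI _ Ts); split; first exact: TA.
exists ((\prod_j s j) *: y); split=> [|j]; rewrite linear_formZ ?yi ?mulr1//.
rewrite (bigD1 j)//= mulrAC; apply: (subringM integral_subring).
  by have [] := sP j.
apply: (subring_prod integral_subring) => l _.
by apply: TA; have [] := sP l.
Qed.

End integral_closure.

(** * Lattices *)

Section lattices.
Variables (F : fieldType) (K : fieldExtType F) (B D : set F).

Let d := \dim {:K}.
Definition bcoord (j : 'I_d) (x : K) : F := coord (vbasis {:K}) j x.
Definition bvect (j : 'I_d) : K := (vbasis {:K})`_j.

Lemma bcoordE (x : K) : x = \sum_j bcoord j x *: bvect j.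
Proof. exact: coord_vbasis (memvf x). Qed.

Lemma bcoordD j x y : bcoord j (x + y) = bcoord j x + bcoord j y.
Proof. exact: linearD. Qed.

Lemma bcoordZ j a x : bcoord j (a *: x) = a * bcoord j x.
Proof. exact: linearZ. Qed.

Lemma bcoord_sum (c : 'I_d -> F) i : bcoord i (\sum_j c j *: bvect j) = c i.
Proof. exact: coord_sum_free (basis_free (vbasisP _)). Qed.

Hypothesis B_ring : is_subring B.
Hypothesis D_mul : forall a b, D a -> D b -> D (a * b).
Hypothesis D1 : D 1.
Hypothesis D_sub : D `<=` B.
Hypothesis D_frac : forall a, exists2 b, D b & B (b * a).

Definition std_lattice : set K := [set x | forall j, B (bcoord j x)].

(** Finite generation is replaced by commensurability with the lattice of a fixed basis: [N]
    contains it, and one denominator carries [N] into it. *)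
Definition is_lattice (N : set K) : Prop :=
  [/\ forall x y, N x -> N y -> N (x + y), forall b x, B b -> N x -> N (b *: x),
      std_lattice `<=` N & exists2 b, D b & forall x, N x -> std_lattice (b *: x)].

Lemma std_lattice_is_lattice : is_lattice std_lattice.
Proof.
split => //.
- by move=> x y Nx Ny j; rewrite bcoordD; exact: (subringD B_ring).
- by move=> b x Bb Nx j; rewrite bcoordZ; exact: (subringM B_ring).
- by exists 1 => // x; rewrite scale1r.
Qed.

Section lattice_theory.
Variable N : set K.
Hypothesis NL : is_lattice N.

Lemma latticeD x y : N x -> N y -> N (x + y).
Proof. by case: NL => + _ _ _; exact. Qed.

Lemma latticeZ b x : B b -> N x -> N (b *: x).
Proof. by case: NL => _ + _ _; exact. Qed.

Lemma lattice0 : N 0.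
Proof.
case: NL => _ _ + _; apply => j; rewrite -(scale0r 0) bcoordZ mul0r.
exact: (subring0 B_ring).
Qed.

Lemma latticeB x y : N x -> N y -> N (x - y).
Proof.
move=> Nx Ny; apply: latticeD => //; rewrite -scaleN1r; apply: latticeZ => //.
apply: (subringN B_ring); exact: (subring1 B_ring).
Qed.

Lemma lattice_sum (I : Type) (s : seq I) (P : pred I) (f : I -> K) :
  (forall i, P i -> N (f i)) -> N (\sum_(i <- s | P i) f i).
Proof.
by move=> Nf; elim/big_ind : _ => //; [exact: lattice0|exact: latticeD].
Qed.

End lattice_theory.

Lemma common_denom (I : Type) (s : seq I) (P : F -> I -> Prop) :
  (forall i, exists2 b, D b & P b i) ->
  (forall i b c, D c -> P b i -> P (c * b) i) ->
  exists2 b, D b & forall i, List.In i s -> P b i.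
Proof.
move=> Pex PM; elim: s => [|i s [b Db bP]]; first by exists 1.
have [c Dc cP] := Pex i; exists (b * c); first exact: D_mul.
move=> j [<-|/bP bj]; first exact: PM.
by rewrite mulrC; exact: PM.
Qed.

Lemma common_denom_fin (I : finType) (P : F -> I -> Prop) :
  (forall i, exists2 b, D b & P b i) ->
  (forall i b c, D c -> P b i -> P (c * b) i) ->
  exists2 b, D b & forall i, P b i.
Proof.
move=> Pex PM; have [b Db bP] := common_denom (enum I) Pex PM.
exists b => // i; apply: bP.
have : i \in enum I by rewrite mem_enum.
by elim: (enum I) => //= a s IH; rewrite inE => /predU1P[->|/IH]; [left|right].
Qed.

Lemma std_denom (x : K) : exists2 b, D b & std_lattice (b *: x).
Proof.
have [i|j b c Dc Bb|b Db bP] :=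
    @common_denom_fin _ (fun b j => B (b * bcoord j x)).
- exact: D_frac.
- by rewrite -mulrA; apply: (subringM B_ring) => //; exact: D_sub.
- by exists b => // j; rewrite bcoordZ.
Qed.

Lemma std_lattice_mul_denom (y : K) : exists2 b, D b &
  forall x, std_lattice x -> std_lattice (b *: (y * x)).
Proof.
have [i|j b c Dc Bb|b Db bP] :=
    @common_denom_fin _ (fun b j => std_lattice (b *: (y * bvect j))).
- exact: std_denom.
- rewrite -scalerA; apply: (latticeZ std_lattice_is_lattice) => //.
  exact: D_sub.
exists b => // x Ex; rewrite (bcoordE x) mulr_sumr scaler_sumr.
apply: (lattice_sum std_lattice_is_lattice) => j _.
rewrite -scalerAr scalerA mulrC -scalerA.
exact: (latticeZ std_lattice_is_lattice).
Qed.

(** [b] carries [N] into the standard lattice, [c] compensates for [y] there, and the standard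
    lattice lies in [N]. *)
Lemma lattice_mul_denom N (y : K) : is_lattice N ->
  exists2 b, D b & forall x, N x -> N (b *: (y * x)).
Proof.
move=> NL; have [_ _ EN [b Db bN]] := NL.
have [c Dc cP] := std_lattice_mul_denom y.
exists (c * b); first exact: D_mul.
move=> x /bN /cP Ex; apply: EN.
by rewrite -scalerA scalerAr.
Qed.

(** The new lattice is N + N y + ... + N y^e, where [p] has degree e + 1. Multipliers of [N] act on
    it termwise, so stability obtained earlier is kept. *)
Lemma lattice_adjoin N (y : K) (p : {poly F}) : is_lattice N ->
  p \is monic -> (forall i, B p`_i) -> root (map_poly (in_alg K) p) y ->
  exists N', [/\ is_lattice N', forall x, N' x -> N' (y * x) &
    forall z, (forall x, N x -> N (z * x)) -> forall x, N' x -> N' (z * x)].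
Proof.
move=> NL p_monic pB py; have [_ _ EN [b Db bN]] := NL.
have [e pe] : exists e, size p = e.+2.
  case sp: (size p) => [|[|e]]; last by exists e.
    by move/eqP: sp; rewrite size_poly_eq0 (negPf (monic_neq0 p_monic)).
  move: py; rewrite rootE (size1_polyC (p := p)) ?sp// map_polyC hornerC/=.
  have := monicP p_monic; rewrite lead_coefE sp/= => ->.
  by rewrite scale1r oner_eq0.
have ye : y ^+ e.+1 = - \sum_(i < e.+1) p`_i *: y ^+ i.
  move: py; rewrite rootE (@horner_coef_wide _ e.+2) -?pe ?size_poly// pe.
  rewrite big_ord_recr/= !coef_map/= addrC.
  have := monicP p_monic; rewrite lead_coefE pe/= => ->.
  rewrite scale1r mul1r addr_eq0 => /eqP ->; congr (- _).
  by apply: eq_bigr => i _; rewrite coef_map/= mulr_algl.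
pose N' := [set x | exists u : nat -> K, (forall i, N (u i)) /\
  x = \sum_(i < e.+1) u i * y ^+ i].
have N0 := lattice0 NL.
exists N'; split; last 2 first.
- move=> _ [u [Nu ->]].
  (* Multiplication by [y] shifts the coefficients; the overflow u_e y^(e+1) is rewritten by
     [ye]. *)
  exists (fun i => (if i is i'.+1 then u i' else 0) - p`_i *: u e); split.
    move=> i; apply: latticeB => //; first by case: i.
    by apply: latticeZ.
  rewrite big_ord_recr/= mulrDr mulr_sumr.
  under [RHS]eq_bigr do rewrite mulrBl.
  rewrite sumrB big_ord_recl/= mul0r add0r; congr (_ + _).
    apply: eq_bigr => i _; rewrite /bump/= add1n exprS; ring.
  rewrite mulrCA -exprS ye mulrN mulr_sumr; congr (- _).
  by apply: eq_bigr => i _; rewrite -scalerAl scalerAr.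
- move=> z zN _ [u [Nu ->]]; exists (fun i => z * u i); split.
    by move=> i; exact: zN.
  by rewrite mulr_sumr; apply: eq_bigr => i _; rewrite mulrA.
split.
- move=> _ _ [u [Nu ->]] [u' [Nu' ->]]; exists (fun i => u i + u' i); split.
    by move=> i; exact: latticeD.
  by rewrite -big_split; apply: eq_bigr => i _; rewrite mulrDl.
- move=> c _ Bc [u [Nu ->]]; exists (fun i => c *: u i); split.
    by move=> i; exact: latticeZ.
  by rewrite scaler_sumr; apply: eq_bigr => i _; rewrite scalerAl.
- move=> x /EN Nx; exists (fun i => if i is 0%N then x else 0); split.
    by case.
  rewrite big_ord_recl/= mulr1 big1 ?addr0// => i _.
  by rewrite mul0r.
- have [i|i a c Dc aP|c Dc cP] := @common_denom_fin 'I_e.+1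
    (fun b i => forall x, std_lattice x -> std_lattice (b *: (y ^+ i * x))).
  + exact: std_lattice_mul_denom.
  + move=> x /aP Ex; rewrite -scalerA.
    by apply: (latticeZ std_lattice_is_lattice) => //; exact: D_sub.
  exists (c * b); first exact: D_mul.
  move=> _ [u [Nu ->]]; rewrite scaler_sumr.
  apply: (lattice_sum std_lattice_is_lattice) => i _.
  by rewrite -scalerA scalerAl mulrC; apply: cP; exact: bN.
Qed.

Lemma lattice_stable (I : Type) (s : seq I) (y : I -> K) :
  (forall i, exists p : {poly F}, [/\ p \is monic, forall i, B p`_i
    & root (map_poly (in_alg K) p) (y i)]) ->
  exists2 N, is_lattice N &
    forall i, List.In i s -> forall x, N x -> N (y i * x).
Proof.
move=> yP; elim: s => [|i s [N NL Ns]].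
  by exists std_lattice => //; exact: std_lattice_is_lattice.
have [p [p_monic pB py]] := yP i.
have [N' [N'L N'y N'z]] := lattice_adjoin NL p_monic pB py.
exists N' => // j [<-//|/Ns js].
by apply: N'z.
Qed.

Lemma lattice_stable_fin (I : finType) (y : I -> K) :
  (forall i, exists p : {poly F}, [/\ p \is monic, forall i, B p`_i
    & root (map_poly (in_alg K) p) (y i)]) ->
  exists2 N, is_lattice N & forall i x, N x -> N (y i * x).
Proof.
move=> yP; have [N NL Ns] := lattice_stable (enum I) yP; exists N => // i.
apply: Ns; have : i \in enum I by rewrite mem_enum.
by elim: (enum I) => //= a s IH; rewrite inE => /predU1P[->|/IH]; [left|right].
Qed.

End lattices.

(** * The two charts of the projective line *)

Local Notation "x %:F" := (tofrac x) : ring_scope.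

Lemma fracP (R : idomainType) (x : {fraction R}) :
  exists a b : R, b != 0 /\ x = a%:F / b%:F.
Proof.
elim/quotW: x => r; exists (frac r).1, (frac r).2; split; first exact: denom_ratioP.
have d0 := denom_ratioP r.
apply: (canRL (mulfK _)); first by rewrite tofrac_eq0.
rewrite !piE; apply/eqmodP => /=.
rewrite FracField.equivfE /FracField.mulf !numden_Ratio ?mulr1 ?oner_neq0//.
by rewrite mulrC.
Qed.

Section function_field.
Variables (k F : fieldType) (iota : {rmorphism {poly k} -> F}).
Variable K : fieldExtType F.
Hypothesis iota_inj : injective iota.
Hypothesis iota_frac : forall x : F,
  exists a b : {poly k}, b != 0 /\ x = iota a / iota b.
Local Notation T := (iota 'X).

Lemma iota_eq0 f : (iota f == 0) = (f == 0).
Proof. by rewrite -(inj_eq iota_inj) rmorph0. Qed.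

Let T0 : T != 0. Proof. by rewrite iota_eq0 polyX_eq0. Qed.
Let TX n : T ^+ n = iota ('X^n). Proof. by rewrite rmorphXn. Qed.

(* [f] goes to [f(1 / X)]. *)
Definition psi : {poly k} -> F :=
  horner_eval T^-1 \o map_poly (iota \o polyC).
HB.instance Definition _ := GRing.RMorphism.copy psi
  (horner_eval T^-1 \o map_poly (iota \o polyC)).

Definition phi_fin : {poly k} -> K := in_alg K \o iota.
HB.instance Definition _ := GRing.RMorphism.copy phi_fin (in_alg K \o iota).

(** The chart k[1/t] is again an embedding of [{poly k}], so the results on integral closures apply
    to both charts. *)
Definition phi_inf : {poly k} -> K := in_alg K \o psi.
HB.instance Definition _ := GRing.RMorphism.copy phi_inf (in_alg K \o psi).

(** X^N f(1/X), for [f] of degree at most [N]. *)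
Definition revp N (f : {poly k}) : {poly k} := \poly_(i < N.+1) f`_(N - i).

Lemma revpK N (f : {poly k}) : (size f <= N.+1)%N -> revp N (revp N f) = f.
Proof.
move=> sf; apply/polyP => i; rewrite !coef_poly; case: ltnP => [iN|Ni].
  by rewrite ltnS leq_subr subKn.
by rewrite nth_default// (leq_trans sf).
Qed.

Lemma psi_sum (f : {poly k}) N : (size f <= N)%N ->
  psi f = \sum_(i < N) iota (f`_i)%:P / T ^+ i.
Proof.
move=> sf; rewrite /psi /= /horner_eval (@horner_coef_wide _ N).
  by apply: eq_bigr => i _; rewrite coef_map/= exprVn.
exact: leq_trans (size_poly _ _) sf.
Qed.

Lemma iota_sum (f : {poly k}) N : (size f <= N)%N ->
  iota f = \sum_(i < N) iota (f`_i)%:P * T ^+ i.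
Proof.
move=> sf; have {1}-> : f = \poly_(i < N) f`_i.
  apply/polyP => i; rewrite coef_poly; case: ltnP => // Ni.
  by rewrite nth_default// (leq_trans sf).
rewrite poly_def rmorph_sum; apply: eq_bigr => i _.
by rewrite -mul_polyC rmorphM rmorphXn.
Qed.

Lemma psi_revp (f : {poly k}) N : (size f <= N.+1)%N ->
  psi f = iota (revp N f) / T ^+ N.
Proof.
move=> sf; rewrite (psi_sum sf) (@iota_sum (revp N f) N.+1) ?size_poly//.
rewrite mulr_suml (reindex_inj rev_ord_inj); apply: eq_bigr => i _ /=.
rewrite coef_poly ltn_ord subSS -mulrA; congr (_ * _).
have iN : (i <= N)%N by rewrite -ltnS.
apply: (mulIf (expf_neq0 N T0)); rewrite divfK ?expf_neq0//.
have -> : T ^+ N = T ^+ (N - i) * T ^+ i by rewrite -exprD subnK.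
exact: (mulKf (expf_neq0 (N - i) T0)).
Qed.

Lemma iota_revp (f : {poly k}) N : (size f <= N.+1)%N ->
  iota f = T ^+ N * psi (revp N f).
Proof.
move=> sf; rewrite (@psi_revp _ N) ?size_poly// revpK// mulrC divfK//.
exact: expf_neq0.
Qed.

Lemma psi_eq0 f : (psi f == 0) = (f == 0).
Proof.
apply/eqP/eqP => [|->]; last exact: rmorph0.
rewrite (psi_revp (leqnSn _)) => /eqP.
rewrite mulf_eq0 invr_eq0 expf_eq0 (negPf T0) andbF orbF iota_eq0 => /eqP f0.
rewrite -(revpK (leqnSn (size f))) f0; apply/polyP => i.
by rewrite !coef_poly !coef0 if_same.
Qed.

Lemma phi_fin_inj : injective phi_fin.
Proof. by move=> f g /fmorph_inj /iota_inj. Qed.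

Lemma phi_inf_inj : injective phi_inf.
Proof.
move=> f g /fmorph_inj /eqP; rewrite -subr_eq0 -rmorphB psi_eq0 subr_eq0.
by move/eqP.
Qed.

(* [B_fin] is k[X] in k(X) and [B_inf] is the local ring at infinity. *)
Definition B_fin : set F := range (iota).
Definition D_fin : set F := [set iota b | b in [set b : {poly k} | b != 0]].
Definition B_inf : set F := [set x | exists a b : {poly k},
  [/\ b != 0, (size a <= size b)%N & x = iota a / iota b]].
(** 1/t is a uniformizer at infinity, so its powers suffice as denominators. *)
Definition D_inf : set F := range (fun n => T^-1 ^+ n).

Lemma B_fin_ring : is_subring B_fin.
Proof.
split; first by exists 1; rewrite ?rmorph1.
- by move=> _ _ [a _ <-] [b _ <-]; exists (a - b); rewrite ?rmorphB.
- by move=> _ _ [a _ <-] [b _ <-]; exists (a * b); rewrite ?rmorphM.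
Qed.

Lemma D_fin_mul a b : D_fin a -> D_fin b -> D_fin (a * b).
Proof.
move=> [f f0 <-] [g g0 <-]; exists (f * g); last by rewrite rmorphM.
exact: mulf_neq0.
Qed.

Lemma D_fin1 : D_fin 1.
Proof. by exists 1 => /=; rewrite ?rmorph1 ?oner_neq0. Qed.

Lemma D_fin_sub : D_fin `<=` B_fin.
Proof. by move=> _ [b _ <-]; exists b. Qed.

Lemma D_fin_frac a : exists2 b, D_fin b & B_fin (b * a).
Proof.
have [f [g [g0 ->]]] := iota_frac a; exists (iota g); first by exists g.
by exists f => //; rewrite mulrC divfK// iota_eq0.
Qed.

Lemma B_infP (a b : {poly k}) : b != 0 -> (size a <= size b)%N ->
  B_inf (iota a / iota b).
Proof. by exists a, b. Qed.

Lemma size_mul_le (a b c d : {poly k}) : b != 0 -> d != 0 ->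
  (size a <= size b)%N -> (size c <= size d)%N ->
  (size (a * c)%R <= size (b * d)%R)%N.
Proof.
move=> b0 d0 ab cd; apply: leq_trans (size_polyMleq _ _) _.
by rewrite size_mul// -!subn1 leq_sub2r// leq_add.
Qed.

Lemma B_inf_ring : is_subring B_inf.
Proof.
split.
- rewrite -(divr1 1) -(rmorph1 iota); apply: B_infP => //; exact: oner_neq0.
- move=> _ _ [a [b [b0 ab ->]]] [c [d [d0 cd ->]]].
  have -> : iota a / iota b - iota c / iota d = iota (a * d - c * b) / iota (b * d).
    by rewrite -mulNr addf_div ?iota_eq0// mulNr -!rmorphM -rmorphB.
  apply: B_infP; first exact: mulf_neq0.
  apply: leq_trans (size_polyD _ _) _; rewrite size_polyN geq_max.
  by rewrite (mulrC c) !size_mul_le.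
- move=> _ _ [a [b [b0 ab ->]]] [c [d [d0 cd ->]]].
  rewrite mulf_div -!rmorphM; apply: B_infP; first exact: mulf_neq0.
  exact: size_mul_le.
Qed.

Lemma D_inf_mul a b : D_inf a -> D_inf b -> D_inf (a * b).
Proof. by move=> [i _ <-] [j _ <-]; exists (i + j)%N; rewrite ?exprD. Qed.

Lemma D_inf1 : D_inf 1.
Proof. by exists 0%N. Qed.

Lemma D_inf_sub : D_inf `<=` B_inf.
Proof.
move=> _ [i _ <-]; rewrite exprVn TX -[_^-1]mul1r -(rmorph1 iota); apply: B_infP.
  by rewrite expf_neq0 ?polyX_eq0.
by rewrite size_poly1 size_polyXn.
Qed.

Lemma D_inf_frac a : exists2 b, D_inf b & B_inf (b * a).
Proof.
have [f [g [g0 ->]]] := iota_frac a; exists (T^-1 ^+ size f); first by exists (size f).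
rewrite exprVn TX mulrC -mulrA -invfM -rmorphM; apply: B_infP.
  by rewrite mulf_neq0// expf_neq0 ?polyX_eq0.
rewrite size_mul ?expf_neq0 ?polyX_eq0// size_polyXn addnS/=.
exact: leq_addl.
Qed.

(** The minimal polynomial over [F], with denominators cleared; its degree is that of F(x) over
    F. *)
Lemma phi_fin_alg x : exists q : {poly {poly k}},
  [/\ q != 0, (size q <= (\dim {:K}).+1)%N & root (map_poly phi_fin q) x].
Proof.
have /polyOver1P[q qE] := minPolyOver 1 x.
have q0 : q != 0.
  apply/eqP => q0; have := monic_minPoly 1 x.
  by rewrite qE q0 map_poly0 monicE lead_coef0 eq_sym oner_eq0.
have [i|i b c Dc Bb|b [b' /= b0 bE] bP] := @common_denom_fin F D_fin
    D_fin_mul D_fin1 'I_(size q) (fun b i => B_fin (b * q`_i)).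
- exact: D_fin_frac.
- by rewrite -mulrA; apply: (subringM B_fin_ring) => //; exact: D_fin_sub.
have /choice[c cP] (i : nat) : exists c : {poly k}, iota c = b * q`_i.
  have [iq|qi] := ltnP i (size q); last by exists 0; rewrite nth_default// mulr0 rmorph0.
  by have [c _ cE] := bP (Ordinal iq); exists c.
pose q' := \poly_(i < size q) c i.
have q'E : map_poly iota q' = b *: q.
  apply/polyP => i; rewrite coef_map coefZ coef_poly /=.
  by case: ltnP => [_|qi]; rewrite ?cP// rmorph0 nth_default// mulr0.
exists q'; split.
- apply/eqP => q'0; move: q'E; rewrite q'0 map_poly0 => /esym/eqP.
  by rewrite scaler_eq0 (negPf q0) orbF -bE iota_eq0 (negPf b0).
- apply: leq_trans (size_poly _ _) _.
  have -> : size q = size (minPoly 1 x) by rewrite qE size_map_poly.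
  rewrite size_minPoly ltnS.
  have := dim_Fadjoin 1 x; rewrite dimv1 muln1 => <-.
  by apply: dimvS; exact: subvf.
- rewrite map_poly_comp q'E map_polyZ/= rootE hornerZ -qE.
  by have /rootP -> := root_minPoly 1 x; rewrite mulr0.
Qed.

(** An equation over k[t] divided by t^N, with N bounding the degrees of its coefficients, is an
    equation over k[1/t]. *)
Lemma phi_inf_alg x : exists q : {poly {poly k}},
  [/\ q != 0, (size q <= (\dim {:K}).+1)%N & root (map_poly phi_inf q) x].
Proof.
have [q [q0 sq qx]] := phi_fin_alg x.
pose N := \max_(i < size q) size (q`_i)%R.
have qN i : (size (q`_i)%R <= N.+1)%N.
  have [iq|qi] := ltnP i (size q); last by rewrite nth_default// size_poly0.
  apply: leqW.
  exact: (@leq_bigmax _ (fun i : 'I_(size q) => size (q`_i)%R) (Ordinal iq)).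
pose q' := \poly_(i < size q) revp N q`_i.
have q'E i : q'`_i = revp N q`_i.
  rewrite coef_poly; case: ltnP => // qi; rewrite nth_default//.
  by apply/polyP => j; rewrite !coef_poly !coef0 if_same.
have phiE i : phi_fin q`_i = (T ^+ N)%:A * phi_inf (q'`_i).
  by rewrite q'E /phi_fin /phi_inf /= (iota_revp (qN i)) -scalerAl mul1r scalerA.
exists q'; split.
- apply: contraNneq q0 => q'0; apply/eqP/polyP => i; rewrite coef0.
  apply: phi_fin_inj; rewrite phiE q'0 coef0 !rmorph0.
  by rewrite mulr0.
- exact: leq_trans (size_poly _ _) sq.
- move: qx; rewrite !rootE !(@horner_coef_wide _ (size q)); last 2 first.
  + exact: leq_trans (size_poly _ _) (size_poly _ _).
  + exact: size_poly.
  move=> /eqP qx; apply/eqP/(@mulfI _ (T ^+ N)%:A).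
    by rewrite scaler_eq0 oner_eq0 orbF expf_neq0.
  rewrite mulr0 -[RHS]qx mulr_sumr; apply: eq_bigr => i _.
  by rewrite !coef_map/= phiE mulrA.
Qed.

Lemma B_inf_psi f : B_inf (psi f).
Proof.
rewrite (psi_revp (leqnSn _)) TX; apply: B_infP.
  by rewrite expf_neq0 ?polyX_eq0.
by rewrite size_polyXn size_poly.
Qed.

Lemma integral_over_fin y : integralOver phi_fin y -> exists p : {poly F},
  [/\ p \is monic, forall i, B_fin p`_i & root (map_poly (in_alg K) p) y].
Proof.
move=> [p p_monic py]; exists (map_poly iota p); split.
- exact: monic_map.
- by move=> i; rewrite coef_map; exists p`_i.
- by rewrite -map_poly_comp.
Qed.

Lemma integral_over_inf y : integralOver phi_inf y -> exists p : {poly F},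
  [/\ p \is monic, forall i, B_inf p`_i & root (map_poly (in_alg K) p) y].
Proof.
move=> [p p_monic py]; exists (map_poly psi p); split.
- exact: monic_map.
- by move=> i; rewrite coef_map; exact: B_inf_psi.
- by rewrite -map_poly_comp.
Qed.

(* Vanishing of H^1 of a line bundle of large degree on the projective line. *)
Lemma frac_split (x : F) (q : {poly k}) m : q != 0 -> (size q <= m)%N ->
  exists a b, [/\ B_fin a, B_inf b & x = iota q * a + T ^+ m * b].
Proof.
move=> q0 qm; have [f [g [g0 ->]]] := iota_frac x.
pose Q := f %/ (q * g); pose S := f %% (q * g).
have qg0 : q * g != 0 by rewrite mulf_neq0.
exists (iota Q), (iota S / iota ('X^m * g)); split; first by exists Q.
  apply: B_infP; first by rewrite mulf_neq0 ?expf_neq0 ?polyX_eq0.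
  apply: ltnW; apply: leq_trans (ltn_modpN0 f qg0) _.
  rewrite !size_mul ?expf_neq0 ?polyX_eq0// size_polyXn addSn/=.
  by apply: leq_trans (leq_pred _) _; rewrite leq_add2r.
rewrite [in LHS](divp_eq f (q * g)) -/Q -/S rmorphD !rmorphM/= -TX.
by field; rewrite iota_eq0 g0 expf_neq0.
Qed.

End function_field.

(** * Solutions over topological fields *)

Lemma probability_of_measure d (T : measurableType d) (R : realType)
    (m : {measure set T -> \bar R}) : m setT = 1%E ->
  exists P : probability T R, forall A, P A = m A.
Proof.
move=> m1; exists (mnormalize m (dirac point)) => A /=.
by rewrite /mnormalize m1 onee_eq0/= invr1 mule1.
Qed.

Lemma pushforward_probability d d' (T : measurableType d)
    (T' : measurableType d') (R : realType) (P : probability T R) (f : T -> T') :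
  measurable_fun setT f ->
  exists Q : probability T' R, forall A, Q A = P (f @^-1` A).
Proof.
move=> mf.
have [|Q QE] := @probability_of_measure _ T' R
  (measure_function_pushforward__canonical__measure_function_Measure P mf).
  by rewrite /= /pushforward preimage_setT probability_setT.
by exists Q => A; rewrite QE.
Qed.

Lemma uniform_probability d (T : measurableType d) (R : realType) (s : seq T) :
  (0 < size s)%N -> exists P : probability T R,
    forall A, P A = ((count (fun x => x \in A) s)%:R / (size s)%:R)%:E.
Proof.
move=> s0; have c0 : 0 <= (size s)%:R^-1 :> R by rewrite invr_ge0.
pose c := NngNum c0.
pose m : {measure set T -> \bar R} :=
  mscale c (msum (fun i => dirac (nth point s i)) (size s)).
have mE A : m A = ((count (fun x => x \in A) s)%:R / (size s)%:R)%:E.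
  rewrite /m /= /mscale /= /msum.
  under eq_bigr do rewrite /= diracE.
  rewrite sumEFin -EFinM mulrC; congr (_ / _)%:E.
  rewrite -natr_sum; congr _%:R.
  rewrite -sum1_count (big_nth point) big_mkord [RHS]big_mkcond.
  by apply: eq_bigr => i _; case: (_ \in _).
have [|P PE] := @probability_of_measure _ T R m.
  rewrite mE (_ : count _ _ = size s) ?divff// ?pnatr_eq0 -?lt0n//.
  by apply/eqP; rewrite -all_count; apply/allP => x _; rewrite in_setT.
by exists P => A; rewrite PE mE.
Qed.

(** All fibres over the image have the size of the kernel, so the uniform law on the group [s] maps
    to the uniform law on [us]. The equality of frequencies is cross-multiplied. *)
Lemma count_fiber (G H : zmodType) (f : G -> H) (s : seq G) (us : seq H) :
  {morph f : x y / x - y} -> uniq s -> uniq us ->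
  (forall x y, x \in s -> y \in s -> x - y \in s) ->
  (forall u, u \in us <-> exists2 x, x \in s & f x = u) ->
  forall B : pred H,
    (count (fun x => B (f x)) s * size us = count B us * size s)%N.
Proof.
move=> fB us_s us_us sB usP.
have f0 : f 0 = 0 by rewrite -(subrr 0) fB subrr.
pose c := count (fun x => f x == 0) s.
have cu u : u \in us -> count (fun x => f x == u) s = c.
  move=> /usP[x0 sx0 fx0]; rewrite /c -!size_filter.
  (* Translation by [- x0] carries the fibre over [u] onto the kernel. *)
  rewrite -(size_map (fun x => x - x0)); apply/eqP.
  rewrite -uniq_size_uniq.
  - by rewrite map_inj_uniq ?filter_uniq//; exact: addIr.
  - by rewrite filter_uniq.
  - move=> x; rewrite mem_filter; apply/idP/mapP => [/andP[/eqP fx sx]|].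
      exists (x + x0); last by rewrite addrK.
      have s0 : - x0 \in s by rewrite -sub0r -{1}(subrr x0) !sB.
      have -> : x + x0 = x - - x0 by rewrite opprK.
      rewrite mem_filter sB// andbT fB fx -[- x0]sub0r fB f0 fx0.
      by rewrite !sub0r opprK.
    move=> [y + ->]; rewrite mem_filter => /andP[/eqP fy sy].
    by rewrite fB fy fx0 subrr eqxx sB.
have key (B : pred H) : count (fun x => B (f x)) s = (count B us * c)%N.
  rewrite -!sum1_count big_mkcond/= big_distrl/= [RHS]big_mkcond/=.
  transitivity (\sum_(x <- s) \sum_(u <- us) (B u && (f x == u) : nat))%N.
    apply: eq_big_seq => x sx; have usfx : f x \in us by apply/usP; exists x.
    rewrite (bigD1_seq (f x))//= eqxx andbT big1 ?addn0; first by case: (B _).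
    by move=> u /negPf; rewrite eq_sym => ->; rewrite andbF.
  rewrite exchange_big/=; apply: eq_big_seq => u /cu uc.
  case: (B u) => /=; last by rewrite big1.
  by rewrite mul1n -uc -sum1_count [RHS]big_mkcond; apply: eq_bigr => x _; case: eqP.
move=> B; have := key predT; rewrite !count_predT key => ->.
by rewrite -mulnA (mulnC c).
Qed.

Lemma negligible_dirac d (T : measurableType d) (R : realType)
    (P : probability T R) (x : T) : P.-negligible (~` [set x]) ->
  forall B, measurable B -> P B = dirac x B.
Proof.
move=> Px B mB; have [Bx|Bx] := pselect (B x); rewrite diracE.
  rewrite mem_set//; apply/eqP; rewrite -[X in P X]setCK probability_setC.
    rewrite (_ : P (~` B) = 0%E) ?sube0//; apply/measure_negligible.
      exact: measurableC.
    by apply: negligibleS Px => y By yx; apply: By; rewrite yx.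
  exact: measurableC.
rewrite memNset//; apply/measure_negligible => //.
by apply: negligibleS Px => y By yx; apply: Bx; rewrite -yx.
Qed.

Lemma borel_open (F : preTopologicalFieldType) (A : set F) :
  open A -> measurable (A : set (borel F)).
Proof. exact: sub_sigma_algebra. Qed.

Lemma borel_rV_open (F : preTopologicalFieldType) r (A : set 'rV[F]_r) :
  open A -> measurable (A : set (borel 'rV[F]_r)).
Proof. exact: sub_sigma_algebra. Qed.

(** * Finitely supported solutions over a discrete field *)

Section discrete.
Variables (F : preTopologicalFieldType) (R : realType) (n r : nat).
Variable L : 'I_n -> 'rV[F]_r.
Hypothesis F_discrete : forall A : set F, open A.

Lemma discrete_measurable (A : set F) : measurable (A : set (borel F)).
Proof. exact: borel_open. Qed.

Lemma discrete_rV_open (A : set 'rV[F]_r) : open A.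
Proof.
rewrite openE => x Ax.
exists (fun i j => [set x i j]) => [i j|y xy].
  exact: open_nbhs_nbhs.
by rewrite (_ : y = x)//; apply/matrixP => i j; rewrite xy.
Qed.

Lemma discrete_rV_measurable (A : set 'rV[F]_r) :
  measurable (A : set (borel 'rV[F]_r)).
Proof.
by apply: borel_rV_open; exact: discrete_rV_open.
Qed.

Lemma seq_solution (s : seq 'rV[F]_r) : (exists2 x, x \in s & x != 0) ->
  (forall (i j : 'I_n) (B : pred F),
     count (fun x => B (linear_form (L i) x)) s =
     count (fun x => B (linear_form (L j) x)) s) ->
  has_solution R L.
Proof.
move=> [x0 sx0 x00] sL.
have s0 : (0 < size s)%N by case: s sx0 {sL}.
have sR : (size s)%:R != 0 :> R by rewrite pnatr_eq0 -lt0n.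
have [mu muE] := @uniform_probability _ (borel 'rV[F]_r) R s s0.
exists mu; split.
- exists [set` s]; split; [|exact: discrete_rV_measurable|].
    by apply: finite_compact; exact: finite_seq.
  rewrite muE (_ : count _ _ = size s) ?divff//.
  by apply/eqP; rewrite -all_count; apply/allP => x sx; rewrite inE.
- move=> /(_ [set x0] (discrete_rV_measurable _)).
  rewrite muE diracE memNset; last by move=> /= /esym/eqP; rewrite (negPf x00).
  move=> -[] /eqP; rewrite mulf_eq0 invr_eq0 (negPf sR) orbF pnatr_eq0.
  by rewrite -leqn0 leqNgt -has_count => /hasPn/(_ _ sx0)/negP; apply; rewrite inE.
- move=> i j B _; rewrite /pushforward !muE; congr (_%:R / _)%:E.
  have := sL i j (fun y => y \in B); congr (_ = _); apply: eq_count => x /=;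
    by apply/idP/idP => /set_mem ?; exact/mem_set.
Qed.

(** The point mass at [x] is a solution. *)
Lemma kernel_solution x : x != 0 -> (forall i, linear_form (L i) x = 0) ->
  has_solution R L.
Proof.
move=> x0 Lx; apply: (@seq_solution [:: x]); first by exists x; rewrite ?inE.
by move=> i j B /=; rewrite !Lx.
Qed.

(** By [count_fiber], every form maps the uniform law on the group [V] to the uniform law on [U]. *)
Lemma finite_system_solution (V : set 'rV[F]_r) (U : set F) :
  finite_set V -> (forall x y, V x -> V y -> V (x - y)) ->
  (exists2 x, V x & x != 0) ->
  (forall i, [set linear_form (L i) x | x in V] = U) -> has_solution R L.
Proof.
move=> Vfin VB [x0 Vx0 x00] VU.
(* Without any form, every point is vacuously a common zero. *)
have [i0|n0] := pselect (exists i : 'I_n, True); last first.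
  by apply: (kernel_solution x00) => i; exfalso; apply: n0; exists i.
have {i0}[i0 _] := i0.
have Ufin : finite_set U by rewrite -(VU i0); exact: finite_image.
have /finite_seqP[us' usE] := Ufin; have /finite_seqP[s' sE] := Vfin.
pose s := undup s'; pose us := undup us'.
have sP x : x \in s <-> V x by rewrite sE mem_undup.
have usP u : u \in us <-> U u by rewrite usE mem_undup.
have us0 : (0 < size us)%N.
  have /usP : U (linear_form (L i0) x0) by rewrite -(VU i0); exists x0.
  by rewrite lt0n size_eq0; case: eqP => // ->.
apply: (@seq_solution s); first by exists x0 => //; exact/sP.
suff key i (B : pred F) : (count (fun x => B (linear_form (L i) x)) s * size us =
    count B us * size s)%N.
  by move=> i j B; apply/eqP; rewrite -(eqn_pmul2r us0) !key.
apply: count_fiber; rewrite ?undup_uniq//.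
- by move=> x y; exact: linear_formB.
- by move=> x y /sP Vx /sP Vy; apply/sP; exact: VB.
- move=> u; split=> [/usP|[x /sP Vx <-]]; last by apply/usP; rewrite -(VU i); exists x.
  by rewrite -(VU i) => -[x /sP sx <-]; exists x.
Qed.

(** The law is pushed forward along [e]. Compact sets of the discrete source are finite, so their
    images are compact, and they are measurable because singletons are closed. *)
Lemma solution_map (F' : preTopologicalFieldType) (e : {rmorphism F -> F'}) :
  (forall x : F', open (~` [set x])) ->
  has_solution R L -> has_solution R (fun i => map_mx e (L i)).
Proof.
move=> F'_T1 [mu [[C [Ccpt _ muC]] mu0 muL]].
pose f (x : borel 'rV[F]_r) : borel 'rV[F']_r := map_mx e (x : 'rV[F]_r).
have f_inj : injective f.
  move=> x y /matrixP xy; apply/matrixP => i j.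
  by apply: (fmorph_inj e); have := xy i j; rewrite !mxE.
have set1_meas (x : 'rV[F']_r) : measurable ([set x] : set (borel 'rV[F']_r)).
  rewrite -[X in measurable X]setCK; apply: measurableC; apply: borel_rV_open.
  rewrite openE => y /= yx.
  have [j yj] : exists j, y 0 j != x 0 j.
    apply/not_existsP => yxj; apply: yx; apply/rowP => j.
    by apply/eqP/negPn/negP; exact: yxj.
  exists (fun i l => if l == j then ~` [set x 0 j] else setT).
    move=> i l; case: eqP => [->|_]; last exact: filterT.
    by apply: open_nbhs_nbhs; split=> //=; rewrite (ord1 i); exact/eqP.
  by move=> z /(_ 0 j); rewrite eqxx => /= zj zx; apply: zj; rewrite zx.
have f_meas : measurable_fun setT f.
  by move=> _ B _; exact: discrete_rV_measurable.
have [nu nuE] := pushforward_probability mu f_meas.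
have fC : finite_set [set f x | x in C].
  apply: finite_image.
  move: Ccpt; rewrite compact_cover => /(_ 'rV[F]_r C (fun x => [set x])).
  case=> [x _|x Cx|D _ CD]; first by exact: discrete_rV_open.
    by exists x.
  by apply: (@finite_subfset _ D) => x /CD[y yD ->].
exists nu; split.
- exists [set f x | x in C]; split.
  + exact: finite_compact.
  + rewrite (_ : [set f x | x in C] = \bigcup_(y in [set f x | x in C]) [set y]).
      exact: fin_bigcup_measurable.
    by apply/seteqP; split=> [y Cy|y [z Cz ->]]//; exists y.
  + rewrite nuE -muC; congr (mu _); apply/seteqP; split=> [x [y Cy /f_inj <-]|]//.
    by move=> x Cx; exists x.
(* By injectivity only 0 maps to 0, so if the image law were the point mass at 0, [mu] would be
   too. *)
- move=> nu0; apply: mu0; apply: negligible_dirac.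
  have -> : ~` [set 0] = f @^-1` (~` [set 0 : 'rV[F']_r]).
    rewrite -preimage_setC; congr (~` _); apply/seteqP; split=> x /=.
      by move=> ->; apply/rowP => j; rewrite !mxE rmorph0.
    by move=> x0; apply: f_inj; rewrite x0; apply/rowP => j; rewrite !mxE rmorph0.
  apply/negligibleP; first exact: discrete_rV_measurable.
  apply: (etrans (esym (nuE _))); rewrite nu0; last exact: measurableC.
  by rewrite diracE memNset// => /(_ erefl).
- move=> i j B mB; rewrite /pushforward !nuE.
  have lin l : f @^-1` (linear_form (map_mx e (L l)) @^-1` B) =
      linear_form (L l) @^-1` (e @^-1` B).
    apply/seteqP; split=> x /=; congr B; rewrite /linear_form rmorph_sum;
      by apply: eq_bigr => m _; rewrite !mxE rmorphM.
  rewrite !lin; exact: (muL i j (e @^-1` B) (discrete_measurable _)).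
Qed.

End discrete.

(** * Solutions over a discretely valued field *)

Section adic.
Variables (K : fieldType) (w : discrete_valuation K).

Lemma adic_ball_open (c : K) N :
  open [set y : adic w | dv_small w N ((y : K) - c)].
Proof.
rewrite openE => y /= yc; apply/adic_nbhsP; exists N => z zy /=.
by rewrite -(subrKA (y : K)); exact: dv_smallD.
Qed.

Lemma adic_T1 (x : adic w) : open (~` [set x]).
Proof.
rewrite openE => y /= yx; apply/adic_nbhsP; exists (w ((x : K) - (y : K)) + 1) => z zy zx.
move: zy; rewrite zx dv_smallE; last first.
  by rewrite subr_eq0; apply/eqP => xy; apply: yx.
by rewrite leNgt ltrDl ltr01.
Qed.

Variables (R : realType) (n r : nat) (L : 'I_n -> 'rV[adic w]_r).
Implicit Types (N : int).

Definition adic_tube (a : 'rV[adic w]_r) N : set 'rV[adic w]_r :=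
  [set x | dv_small w N (linear_form a x : K)].

Lemma adic_tube_open a N : open (adic_tube a N).
Proof.
rewrite openE => x Nx.
(* This precision in coordinate [j] compensates for the coefficient [a 0 j]; at a zero coefficient
   any precision would do, so the junk value is harmless. *)
exists (fun _ j => [set y : adic w |
  dv_small w (N - w (a 0 j : K)) ((y : K) - (x 0 j : K))]).
  move=> i j; rewrite (ord1 i); apply/adic_nbhsP.
  by exists (N - w (a 0 j : K)).
move=> y yx /=; rewrite /adic_tube /= -[X in dv_small _ _ X](subrK (linear_form a x)).
apply: dv_smallD => //; rewrite -linear_formB.
apply: dv_small_sum => j _; rewrite !mxE.
rewrite -[N](subrKC (w (a 0 j : K))); apply: dv_smallM; first by right.
exact: yx.
Qed.

Lemma adic_tube_measurable a N :
  measurable (adic_tube a N : set (borel 'rV[adic w]_r)).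
Proof. by apply: borel_rV_open; exact: adic_tube_open. Qed.

(* The smallest ball containing almost all values of [L i] is the same for all
   [i]; the value of [L i] at almost every point is in that ball, and it is on
   its boundary with positive probability. *)
Lemma adic_solution_maximal :
  (forall x, (forall i, linear_form (L i) x = 0) -> x = 0) ->
  has_solution R L -> forall i, exists N x,
    [/\ linear_form (L i) x != 0, w (linear_form (L i) x : K) = N &
      forall j, adic_tube (L j) N x].
Proof.
move=> L_inj [mu [[C [Ccpt mC muC]] mu0 muL]] i0.
pose S i N : set (borel 'rV[adic w]_r) := adic_tube (L i) N.
have mS i N : measurable (S i N) by exact: adic_tube_measurable.
have SE i j N : mu (S i N) = mu (S j N).
  have /(muL i j) : measurable
      ([set y : adic w | dv_small w N (y : K)] : set (borel (adic w))).
    have := @adic_ball_open 0 N; under eq_set do rewrite subr0.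
    exact: borel_open.
  by [].
have S_le i M N : M <= N -> S i N `<=` S i M.
  by move=> MN x; exact: dv_small_le.
have negS i N : mu.-negligible (~` S i N) <-> mu (S i N) = 1%E.
  have mSC : measurable (~` S i N) by exact: measurableC.
  have m0 : mu (~` S i N) = 0%E <-> mu (S i N) = 1%E.
    rewrite probability_setC//; have fS := fin_num_measure mu _ (mS i N).
    split=> [/eqP|->]; last by rewrite subee.
    by rewrite sube_eq ?add0e// ?fin_num_adde_defl// => /eqP.
  split=> [/(negligibleP _ mSC)/m0//|/m0 m1].
  by apply/negligibleP.
have neg_all (P : 'I_n -> set (borel 'rV[adic w]_r)) :
    (forall i, mu.-negligible (P i)) -> mu.-negligible (\bigcup_i P i).
  move=> Pneg; rewrite (_ : \bigcup_i P i =
      \bigcup_k [set x | exists2 i : 'I_n, i = k :> nat & P i x]).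
    apply: negligible_bigcup => k; have [kn|nk] := ltnP k n.
      apply: negligibleS (Pneg (Ordinal kn)) => x [i ik].
      by congr (P _ x); exact: val_inj.
    rewrite (_ : [set x | _] = set0); first exact: negligible_set0.
    by apply/seteqP; split => // x [i ik]; move: nk; rewrite -ik leqNgt ltn_ord.
  apply/seteqP; split=> x.
    by move=> [i _ Pix]; exists (i : nat) => //; exists i.
  by move=> [k _ [i _ Pix]]; exists i.
(* The tubes exhaust the space, so finitely many of them, hence a single one, cover the compact
   carrier. *)
have [N0 SN0] : exists N0, mu (S i0 N0) = 1%E.
  have CS : C `<=` \bigcup_(k : nat) S i0 (- k%:Z).
    move=> x _; exists `|w (linear_form (L i0) x : K)|%N => //.
    by right; rewrite lerNl -abszN; exact: lez_abs.
  move: Ccpt; rewrite compact_cover => /(_ nat setT (fun k => S i0 (- k%:Z))).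
  case=> [k _|//|D _ CD]; first exact: adic_tube_open.
  exists (- (\max_(k <- finmap.enum_fset D) k)%N%:Z); apply/eqP.
  rewrite eq_le; apply/andP; split.
    exact: probability_le1.
  rewrite -muC; apply: le_measure; rewrite ?inE//.
  move=> x /CD[k /= kD]; apply: S_le; rewrite lerN2 lez_nat.
  by apply: leq_bigmax_seq.
(* If all tubes had full mass, almost every point would be a common zero of the forms, and [mu] the
   point mass at 0. *)
have [N1 SN1] : exists N1, mu (S i0 N1) <> 1%E.
  apply/existsNP => S1; apply: mu0; apply: negligible_dirac.
  apply: (@negligibleS _ _ _ _ (\bigcup_(k : nat) \bigcup_i ~` S i k%:Z)).
    move=> x x0; apply: contrapT => xS; apply: x0; apply: L_inj => i.
    apply: (dv_small_eq0 (w := w)) => N; apply: contrapT => xN; apply: xS.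
    exists `|N|%N => //; exists i => // xS; apply: xN.
    by apply: dv_small_le xS; exact: lez_abs.
  apply: negligible_bigcup => k; apply: neg_all => i; apply/negS.
  by rewrite (SE i i0).
have exk : exists k : nat, `[< mu (S i0 (N0 + k%:Z)) <> 1%E >].
  exists `|N1 - N0|%N; apply/asboolP => S1; apply: SN1.
  apply/eqP; rewrite eq_le; apply/andP; split; first exact: probability_le1.
  rewrite -S1; apply: le_measure; rewrite ?inE//; apply: S_le.
  by rewrite -lerBlDl lez_abs.
(* The first radius without full mass is not [N0] itself; its predecessor [N] is the radius of the
   smallest ball. *)
case: (ex_minnP exk) => -[/asboolP|k /asboolP Sk kmin]; first by rewrite addr0.
have Sk1 : mu (S i0 (N0 + k%:Z)) = 1%E.
  apply: contrapT => /asboolP/kmin; by rewrite ltnn.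
pose N := N0 + k%:Z.
have NE : N0 + k.+1%:Z = N + 1 by rewrite intS /N addrCA addrC.
rewrite NE in Sk.
(* Almost every point lies in all the tubes of radius [N]; if none of these points left the tube
   [S i0 (N + 1)], that tube would have full mass. *)
have [x [xN xS]] : exists x, ~ S i0 (N + 1) x /\ forall j, S j N x.
  apply/not_existsP => H; apply: Sk; apply/negS.
  apply: (@negligibleS _ _ _ _ (\bigcup_i ~` S i N)).
    move=> x xN; apply: contrapT => xS; apply: (H x); split => // j.
    by apply: contrapT => xj; apply: xS; exists j.
  by apply: neg_all => i; apply/negS; rewrite (SE i i0).
have x0 : linear_form (L i0) x != 0.
  by apply/eqP => x0; apply: xN; rewrite /S /adic_tube /= x0; left.
exists N, x; split => //; apply/eqP; rewrite eq_le; apply/andP; split.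
  rewrite -ltzD1 ltNge; apply/negP => xN'; apply: xN; by right.
by have := xS i0; rewrite /S /adic_tube /= dv_smallE.
Qed.

End adic.

Lemma linear_form_map (F F' : fieldType) (e : {rmorphism F -> F'}) r
    (a x : 'rV[F]_r) :
  linear_form (map_mx e a) (map_mx e x) = e (linear_form a x).
Proof.
by rewrite /linear_form rmorph_sum; apply: eq_bigr => m _; rewrite !mxE rmorphM.
Qed.

(** Having no common zero but 0 is a rank condition on the matrix of the forms, hence stable under
    field extension. *)
Lemma linear_form_map_inj (F F' : fieldType) (e : {rmorphism F -> F'}) n r
    (L : 'I_n -> 'rV[F]_r) :
  (forall x, (forall i, linear_form (L i) x = 0) -> x = 0) ->
  forall x, (forall i, linear_form (map_mx e (L i)) x = 0) -> x = 0.
Proof.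
move=> L_inj x Lx; pose M := \matrix_(j < r, i < n) L i 0 j.
have M_free : row_free M.
  rewrite -kermx_eq0; apply/eqP/row_matrixP => l; rewrite row0; apply: L_inj => i.
  have /matrixP/(_ 0 i) : row l (kermx M) *m M = 0.
    by rewrite -row_mul mulmx_ker row0.
  rewrite !mxE => <-; apply: eq_bigr => j _.
  by rewrite !mxE mulrC.
apply/eqP; rewrite -(mulmx_free_eq0 x (B := map_mx e M)) ?row_free_map//.
apply/eqP/rowP => i; rewrite !mxE -[RHS](Lx i); apply: eq_bigr => j _.
by rewrite !mxE mulrC.
Qed.

(** * From the completion back to K *)

Section completion_local.
Variables (K : fieldType) (v : discrete_valuation K) (Kv : completion v).
Variables (R : realType) (n r : nat) (L : 'I_n -> 'rV[K]_r).
Local Notation e := (completion_emb Kv).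
Local Notation w := (completion_dv Kv).

(** A point of K^r close enough to the maximal point over the completion inherits its property, by
    density of [K]. *)
Lemma completed_local :
  (forall x, (forall i, linear_form (L i) x = 0) -> x = 0) ->
  has_solution R (fun i => map_mx e (L i) : 'rV[completed Kv]_r) ->
  forall i, exists x, linear_form (L i) x != 0 /\
    forall j, linear_form (L j) x != 0 ->
      v (linear_form (L i) x) <= v (linear_form (L j) x).
Proof.
move=> L_inj Kv_sol i.
have [N [x [xi0 xiN xS]]] :=
  @adic_solution_maximal _ w R n r _ (linear_form_map_inj (e := e) L_inj) Kv_sol i.
(* [D] bounds the precision lost through any coefficient: coordinates known to precision D + N + 1
   give the forms to precision N + 1, just beyond the valuation N of [L i]. *)
pose D := (\sum_j \sum_l `|w (e (L j 0%R l))|)%N.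
have /choice[y yP] l : exists y : K,
    dv_small w (D%:Z + (N + 1)) (e y - x 0 l).
  have [||z [zx [y _ yz]]] := completion_dense
      (O := [set z : adic w |
        dv_small w (D%:Z + (N + 1)) ((z : completion_field Kv) - x 0 l)]).
  - by exists (x 0 l); rewrite /= subrr; left.
  - exact: adic_ball_open.
  - by exists y; rewrite yz.
pose yv : 'rV[K]_r := \row_l y l.
have near j : dv_small w (N + 1)
    (e (linear_form (L j) yv) - linear_form (map_mx e (L j)) x).
  rewrite -linear_form_map -linear_formB; apply: dv_small_sum => l _.
  rewrite !mxE -[N + 1](addKr D%:Z); apply: dv_smallM; last exact: yP.
  apply: (@dv_small_le _ _ _ (w (e (L j 0 l)))); last by right.
  rewrite lerNl; apply: (@le_trans _ _ `|w (e (L j 0%R l))|%N%:Z).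
    by rewrite -abszN lez_abs.
  rewrite lez_nat /D (bigD1 j)//= (bigD1 l)//= -addnA; exact: leq_addr.
have [yi0 yiN] : e (linear_form (L i) yv) != 0 /\ w (e (linear_form (L i) yv)) = N.
  have := @dv_near _ w (N + 1) _ _ xi0 _ (near i); rewrite xiN; apply.
  by rewrite ltrDl ltr01.
have li0 : linear_form (L i) yv != 0 by rewrite fmorph_eq0 in yi0.
exists yv; split => // j lj0.
rewrite -(completion_dvE Kv li0) yiN -(completion_dvE Kv lj0).
have ej0 : e (linear_form (L j) yv) != 0 by rewrite fmorph_eq0.
rewrite -dv_smallE// -[X in dv_small _ _ X](subrK (linear_form (map_mx e (L j)) x)).
apply: dv_smallD; last exact: xS.
by apply: dv_small_le (near j); rewrite lerDl ler01.
Qed.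

End completion_local.

(** * Global sections *)

Section finite_system.
Variables (k : finFieldType) (F : fieldType) (iota : {rmorphism {poly k} -> F}).
Variable K : fieldExtType F.
Hypothesis iota_inj : injective iota.
Hypothesis iota_frac : forall x : F,
  exists a b : {poly k}, b != 0 /\ x = iota a / iota b.
Local Notation T := (iota 'X).
Local Notation Bf := (B_fin iota).
Local Notation Bi := (B_inf iota).
Local Notation Df := (D_fin iota).
Local Notation Di := (D_inf iota).

Let T0 : T != 0. Proof. by rewrite iota_eq0// polyX_eq0. Qed.
Let Bf_ring := B_fin_ring iota.
Let Bi_ring := B_inf_ring iota_inj.
Let Df_mul := @D_fin_mul _ _ iota.
Let Di_mul := @D_inf_mul _ _ iota.
Let Df1 := D_fin1 iota.
Let Di1 := D_inf1 iota.
Let Df_sub := @D_fin_sub _ _ iota.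
Let Di_sub := @D_inf_sub _ _ iota.
Let Df_frac := D_fin_frac iota_inj iota_frac.
Let Di_frac := D_inf_frac iota_frac.

(** The coordinates of q u are polynomials by the condition at [N], and the condition at [N'] bounds
    their sizes by [s]; [k] is finite. *)
Lemma lattice_inter_finite (N N' : set K) m :
  is_lattice Bf Df N -> is_lattice Bi Di N' ->
  finite_set [set u | N u /\ N' (T^-1 ^+ m *: u)].
Proof.
move=> [_ _ _ [_ [q /= q0 <-] Nq]] [_ _ _ [_ [c _ <-] N'c]].
pose s := (size q + (c + m))%N.
pose h (A : 'M[k]_(\dim {:K}, s)) : K :=
  (iota q)^-1 *: \sum_j iota (rVpoly (row j A)) *: bvect j.
apply: (@sub_finite_set _ _ [set h A | A in [set: 'M[k]_(\dim {:K}, s)]]); last first.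
  by apply: finite_image; exact: finite_finset.
move=> u /= [/Nq qu /N'c cu].
have /choice[f fE] j : exists f : {poly k}, iota f = bcoord j (iota q *: u).
  by have [f _ fE] := qu j; exists f.
have sf j : (size (f j) <= s)%N.
  have [a [b [b0 ab]]] := cu j; rewrite scalerA -exprD.
  rewrite bcoordZ exprVn => E.
  have {}E : iota (f j * b) = iota (a * (q * 'X^(c + m))).
    rewrite !rmorphM/= fE bcoordZ rmorphXn/=.
    have -> : bcoord j u = T ^+ (c + m) * (iota a / iota b).
      by rewrite -E mulVKf// expf_neq0.
    by field; rewrite iota_eq0.
  have [->|fj0] := eqVneq (f j) 0; first by rewrite size_poly0.
  have a0 : a != 0.
    apply/eqP => a0; move/iota_inj/eqP: E; rewrite a0 mul0r mulf_eq0.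
    by rewrite (negPf fj0) (negPf b0).
  move/iota_inj/(congr1 (fun p : {poly k} => size p)): E.
  rewrite !size_mul ?mulf_neq0 ?expf_neq0 ?polyX_eq0// size_polyXn /s.
  move: ab (a0) (b0) (q0); rewrite -!size_poly_gt0; clear.
  move: (size a) (size b) (size q) (size (f j)) => sa sb sq sfj; lia.
exists (\matrix_(j, l) poly_rV (f j) 0 l) => //; rewrite /h.
transitivity ((iota q)^-1 *: \sum_j bcoord j (iota q *: u) *: bvect j).
  congr (_ *: _); apply: eq_bigr => j _; congr (_ *: _).
  rewrite (_ : row j _ = poly_rV (f j)) ?poly_rV_K//.
  by apply/rowP => l; rewrite !mxE.
by rewrite -bcoordE scalerA mulVf ?scale1r// iota_eq0.
Qed.

Variables (n r : nat) (L : 'I_n -> 'rV[K]_r).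
Hypothesis n_gt0 : (0 < n)%N.
Hypothesis L_inj : forall x, (forall i, linear_form (L i) x = 0) -> x = 0.
Hypothesis L_fin : forall i, exists x, linear_form (L i) x = 1 /\
  forall j, integralOver (phi_fin iota K) (linear_form (L j) x).
Hypothesis L_inf : forall i, exists x, linear_form (L i) x = 1 /\
  forall j, integralOver (phi_inf iota K) (linear_form (L j) x).

(** [U] plays the role of the global sections of a line bundle of large degree, and [V] consists of
    the points where all forms take values in [U]. The point is that each [L i] maps [V] onto
    [U]. *)
Lemma finite_system : exists (V : set 'rV[K]_r) (U : set K),
  [/\ finite_set V, forall x y, V x -> V y -> V (x - y),
      exists2 x, V x & x != 0 &
      forall i, [set linear_form (L i) x | x in V] = U].
Proof.
have /choice[x0 x0P] := L_fin; have /choice[x1 x1P] := L_inf.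
have [|N NL Ns] := @lattice_stable_fin F K Bf Df Bf_ring Df_mul Df1 Df_sub Df_frac
    ('I_n * 'I_n)%type (fun ij => linear_form (L ij.2) (x0 ij.1)).
  by move=> ij; apply: (@integral_over_fin _ _ iota); have [_] := x0P ij.1; exact.
have [|N' NL' Ns'] := @lattice_stable_fin _ K Bi Di Bi_ring Di_mul Di1 Di_sub Di_frac
    ('I_n * 'I_n)%type (fun ij => linear_form (L ij.2) (x1 ij.1)).
  by move=> ij; apply: (@integral_over_inf _ _ iota) => //; have [_] := x1P ij.1; exact.
(* [L i] vanishes on [g i], so multiples of [g i] can be added without changing [L i]. The
   denominators [q] and t^(-c) below control the other forms of [g i] on [N] and [N']. *)
pose g i := x0 i - x1 i.
have [ij|ij b c Dc bP x Nx|_ [q /= q0 <-] qP] := @common_denom_fin _ Df Df_mul Df1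
    ('I_n * 'I_n)%type
    (fun b ij => forall x, N x -> N (b *: (linear_form (L ij.2) (g ij.1) * x))).
- exact: (lattice_mul_denom Bf_ring Df_mul Df1 Df_sub Df_frac).
- by rewrite -scalerA; apply: (latticeZ NL); [exact: Df_sub|exact: bP].
have [ij|ij b e De bP x Nx|_ [c _ <-] cP] := @common_denom_fin _ Di Di_mul Di1
    ('I_n * 'I_n)%type
    (fun b ij => forall x, N' x -> N' (b *: (linear_form (L ij.2) (g ij.1) * x))).
- exact: (lattice_mul_denom Bi_ring Di_mul Di1 Di_sub Di_frac).
- by rewrite -scalerA; apply: (latticeZ NL'); [exact: Di_sub|exact: bP].
have [_ _ EN _] := NL; have [_ _ EN' _] := NL'.
(* A nonzero element for [U]; t^(-c') brings it into [N']. *)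
have [y0 [Ny0 y00]] : exists y, N y /\ y != 0.
  have [b [p /= p0 <-] bE] := std_denom (K := K) Bf_ring Df_mul Df1 Df_sub Df_frac 1.
  exists ((iota p)%:A); split; first exact: EN.
  by rewrite scaler_eq0 oner_eq0 orbF iota_eq0.
have [_ [c' _ <-] /EN' Ny0'] := std_denom (K := K) Bi_ring Di_mul Di1 Di_sub Di_frac y0.
(* [size q] is required by [frac_split], [c] absorbs the multiplication by forms of [g i] on [N'],
   and [c'] puts [y0] in [U]. *)
pose m := (size q + c + c')%N.
pose U := [set u | N u /\ N' (T^-1 ^+ m *: u)].
have Di_pow e x : N' x -> N' (T^-1 ^+ e *: x).
  by apply: (latticeZ NL'); apply: Di_sub; exists e.
pose V := [set x | forall j, U (linear_form (L j) x)].
have VU i u : U u -> exists2 x, V x & linear_form (L i) x = u.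
  move=> [Nu N'u].
  have /choice[a aP] j : exists a : F * F, [/\ Bf a.1, Bi a.2 &
      bcoord j u = iota q * a.1 + T ^+ (size q + c') * a.2].
    have [|a [b [Ba Bb E]]] := @frac_split _ _ iota iota_inj iota_frac
        (bcoord j u) q (size q + c') q0.
      exact: leq_addr.
    by exists (a, b).
  pose a0 := \sum_j (a j).1 *: bvect j : K.
  pose b0 := \sum_j (a j).2 *: bvect j : K.
  have Na0 : N a0 by apply: EN => j; rewrite bcoord_sum; have [] := aP j.
  have Nb0 : N' b0 by apply: EN' => j; rewrite bcoord_sum; have [] := aP j.
  have uE : u = iota q *: a0 + T ^+ (size q + c') *: b0.
    rewrite [LHS]bcoordE /a0 /b0 !scaler_sumr -big_split/=; apply: eq_bigr => j _.
    by have [_ _ ->] := aP j; rewrite scalerDl !scalerA.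
  have gi : linear_form (L i) (g i) = 0.
    rewrite linear_formB; have [-> _] := x0P i; have [-> _] := x1P i.
    by rewrite subrr.
  pose w := u *: x0 i - (iota q *: a0) *: g i.
  (* The two expressions of [w] serve the two charts: the first shows that its forms lie in [N], the
     second controls them in [N']. *)
  have wE : w = u *: x1 i + (T ^+ (size q + c') *: b0) *: g i.
    rewrite /w; have -> : x0 i = x1 i + g i by rewrite /g addrC subrK.
    rewrite scalerDr -addrA -scalerBl; congr (_ + _ *: _).
    by rewrite {1}uE addrC addKr.
  exists w; last first.
    rewrite /w linear_formB !linear_formZ gi mulr0 subr0.
    by have [-> _] := x0P i; rewrite mulr1.
  move=> j; split.
    rewrite /w linear_formB !linear_formZ; apply: (latticeB Bf_ring NL).
      by rewrite mulrC; exact: (Ns (i, j)).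
    rewrite -scalerAl mulrC; exact: (qP (i, j)).
  rewrite wE linear_formD !linear_formZ scalerDr; apply: (latticeD NL').
    by rewrite mulrC scalerAr; apply: (Ns' (i, j)).
  rewrite -scalerAl scalerA.
  have -> : T^-1 ^+ m * T ^+ (size q + c') = T^-1 ^+ c.
    rewrite /m -addnA (addnC c) addnA addnC exprD -mulrA -exprMn mulVf//.
    by rewrite expr1n mulr1.
  by rewrite mulrC; exact: (cP (i, j)).
have U_fin : finite_set U by exact: lattice_inter_finite.
have VLU i : [set linear_form (L i) x | x in V] = U.
  rewrite eqEsubset; split; first by move=> _ [x Vx <-]; exact: Vx.
  by move=> u /(VU i)[x Vx <-]; exists x.
exists V, U; split => //.
(* As the forms are jointly injective, [V] embeds into the finite set of families in [U]. *)
- have -> : V = (fun x => [ffun i => linear_form (L i) x]) @^-1`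
      [set f : {ffun 'I_n -> K} | forall i, U (f i)].
    by apply/seteqP; split => x /= Vx i; have := Vx i; rewrite ffunE.
  apply: finite_preimage.
    move=> x y _ _ /ffunP xy; apply/eqP; rewrite -subr_eq0; apply/eqP/L_inj => i.
    by rewrite linear_formB; have := xy i; rewrite !ffunE => ->; rewrite subrr.
  have /finite_seqP[s sE] := U_fin.
  pose h (f : {ffun 'I_n -> seq_sub s}) := [ffun i => val (f i)] : {ffun 'I_n -> K}.
  apply: (@sub_finite_set _ _ [set h f | f in setT]).
    move=> f fU; have sf i : f i \in s by have := fU i; rewrite sE.
    exists [ffun i => SeqSub (sf i)] => //.
    by apply/ffunP => i; rewrite !ffunE.
  by apply: finite_image; exact: finite_finset.
- move=> x y Vx Vy j; have [Nx N'x] := Vx j; have [Ny N'y] := Vy j.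
  rewrite linear_formB; split; first exact: (latticeB Bf_ring NL).
  by rewrite scalerBr; exact: (latticeB Bi_ring NL').
- have [|x Vx xy] := VU (Ordinal n_gt0) y0.
    split => //; rewrite /m exprD -scalerA; exact: Di_pow.
  by exists x => //; apply: contraNneq y00 => x00; rewrite -xy x00 linear_form0.
Qed.

End finite_system.

(** * The local-global principle *)

Lemma local_solution (k : finFieldType) (F : fieldType)
    (iota : {rmorphism {poly k} -> F}) (K : fieldExtType F) (n r : nat)
    (L : 'I_n -> 'rV[K]_r) (R : realType) :
  injective iota ->
  (forall x : F, exists a b : {poly k}, b != 0 /\ x = iota a / iota b) ->
  (0 < n)%N -> (forall x, (forall i, linear_form (L i) x = 0) -> x = 0) ->
  (forall (w : discrete_valuation K) i, exists x,
    linear_form (L i) x != 0 /\ forall j, linear_form (L j) x != 0 ->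
      w (linear_form (L i) x) <= w (linear_form (L j) x)) ->
  has_solution R (L : 'I_n -> 'rV[discrete_topology K]_r).
Proof.
move=> iota_inj iota_frac n_gt0 L_inj L_local.
have fin_sol := integral_solution (phi_fin_inj (K := K) iota_inj)
  (phi_fin_alg (K := K) iota_inj iota_frac) L_local.
have inf_sol := integral_solution (phi_inf_inj (K := K) iota_inj)
  (phi_inf_alg (K := K) iota_inj iota_frac) L_local.
have [V [U [Vfin VB V0 VU]]] :=
  finite_system iota_inj iota_frac n_gt0 L_inj fin_sol inf_sol.
exact: (@finite_system_solution (discrete_topology K) R n r L
  (fun A => discrete_open A) V U Vfin VB V0 VU).
Qed.

Theorem theorem3p1 (R : realType) (k : finFieldType)
    (K : fieldExtType {fraction {poly k}}) (n r : nat) (hrn : (r < n)%N)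
    (L : 'I_n -> 'rV[K]_r) :
  has_solution R (L : 'I_n -> 'rV[discrete_topology K]_r) <->
  forall (v : discrete_valuation K) (Kv : completion v),
    has_solution R
      (fun i => map_mx (completion_emb Kv) (L i) : 'rV[completed Kv]_r).
Proof.
split=> [L_sol v Kv|L_sol].
  exact: (@solution_map (discrete_topology K) R n r L
    (fun A => discrete_open A) (completed Kv) (completion_emb Kv)
    (@adic_T1 _ (completion_dv Kv)) L_sol).
(* A nonzero common zero is a solution by itself; otherwise the forms are jointly injective. *)
have [[x [x0 Lx]]|no_kernel] :=
    pselect (exists x, x != 0 /\ forall i, linear_form (L i) x = 0).
  exact: (@kernel_solution (discrete_topology K) R n r L
    (fun A => discrete_open A) x x0 Lx).
have L_inj x : (forall i, linear_form (L i) x = 0) -> x = 0.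
  move=> Lx; have [//|x0] := eqVneq x 0.
  by exfalso; apply: no_kernel; exists x.
apply: (@local_solution k _ (@tofrac {poly k}) K n r L R _ _ _ L_inj).
- by move=> f g /eqP; rewrite tofrac_eq => /eqP.
- exact: fracP.
- exact: leq_ltn_trans hrn.
(* The local hypothesis is used at the completion built from Cauchy sequences. *)
- move=> v; apply: (@completed_local _ v (cauchy_completion v) R) => //.
Qed.
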